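(* Let $b\ge 2$ be an integer and let $\boldsymbol a=(a_j)_{j\ge1}$ be a sequence of real numbers with $a_1\le a_2\le a_3\le\cdots$. For $s\in\mathbb N$ consider integration over the Walsh space $\mathcal W_{s,\boldsymbol a,b}$, and let $e(n,s,\mathcal W_{s,\boldsymbol a,b})$ be the $n$-th minimal worst-case error. Then the following hold. 1. There exist positive constants $c_{1,s},c_{2,s},c_{3,s},c_{4,s}$, which may depend on $s$ and $\boldsymbol a$, such that $$\exp\left(-\frac{(\log n)^2}{2s\log b}-c_{1,s}\log n-c_{2,s}\right)\le e(n,s,\mathcal W_{s,\boldsymbol a,b})\le c_{3,s}\exp\left(-c_{4,s}(\log n)^2\right)$$ for all $s,n\in\mathbb N$. In particular $e(n,s,\mathcal W_{s,\boldsymbol a,b})$ is of order $\exp(\Theta(-(\log n)^2))$ in $n$ for each fixed $s$. 2. There do not exist constants $A,C\ge 0$ and $c>0$ such that $e(n,s,\mathcal W_{s,\boldsymbol a,b})\le C\exp(As)\,e^{-c(\log n)^2}$ holds for all $s,n\in\mathbb N$. 3. Let $1<p<2$. Then the following are equivalent: (a) $\liminf_{j\to\infty} a_j/j^{(p-1)/(2-p)}>0$. (b) There exist constants $A,C\ge0$ and $c>0$ such that $e(n,s,\mathcal W_{s,\boldsymbol a,b})\le C\exp(As)\,e^{-c(\log n)^p}$ for all $s,n\in\mathbb N$. (c) There exist constants $C\ge0$ and $c>0$ such that $e(n,s,\mathcal W_{s,\boldsymbol a,b})\le C e^{-c(\log n)^p}$ for all $s,n\in\mathbb N$.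
   Context: $\mathbb N$ is the set of positive integers and $\mathbb N_0=\mathbb N\cup\{0\}$; $b\ge2$ is a fixed integer; $\mathbb Z_b=\{0,1,\dots,b-1\}$; $\omega_b=\exp(2\pi\sqrt{-1}/b)$. Walsh functions: for $k\in\mathbb N_0$ with $b$-adic expansion $k=\sum_{i\ge1}\kappa_ib^{i-1}$ ($\kappa_i\in\mathbb Z_b$) and $x\in[0,1)$ with $b$-adic expansion $x=\sum_{i\ge1}\xi_ib^{-i}$ (infinitely many $\xi_i\ne b-1$), put $\mathrm{wal}_k(x)=\omega_b^{\sum_i\kappa_i\xi_i}$. For $\boldsymbol k\in\mathbb N_0^s$, $\boldsymbol x\in[0,1)^s$ put $\mathrm{wal}_{\boldsymbol k}(\boldsymbol x)=\prod_{j=1}^s\mathrm{wal}_{k_j}(x_j)$. Walsh coefficients: $\widehat f(\boldsymbol k)=\int_{[0,1)^s}f(\boldsymbol x)\overline{\mathrm{wal}_{\boldsymbol k}(\boldsymbol x)}\,d\boldsymbol x$. Generalized Dick weight: let $h(0)=0$ and $h(\kappa)=1$ for $\kappa\ne0$. For $a\in\mathbb R$ and $k=\sum_{i\ge1}\kappa_ib^{i-1}\in\mathbb N_0$, $\mu(a;k)=\sum_{i\ge1}(i+a)h(\kappa_i)$; for $\boldsymbol k\in\mathbb N_0^s$, $\mu(\boldsymbol a;\boldsymbol k)=\sum_{j=1}^s\mu(a_j;k_j)$. Walsh space: $\mathcal W_{s,\boldsymbol a,b}$ is the set of $f:[0,1)^s\to\mathbb R$ with $f(\boldsymbol x)=\sum_{\boldsymbol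 k\in\mathbb N_0^s}\widehat f(\boldsymbol k)\mathrm{wal}_{\boldsymbol k}(\boldsymbol x)$ and $\|f\|_{\mathcal W_{s,\boldsymbol a,b}}:=\sup_{\boldsymbol k\in\mathbb N_0^s}|\widehat f(\boldsymbol k)\,b^{\mu(\boldsymbol a;\boldsymbol k)}|<\infty$ (such series converge absolutely). Minimal error: let $I(f)=\int_{[0,1)^s}f(\boldsymbol x)\,d\boldsymbol x$. An algorithm using $n$ function values is $A_{n,s}(f)=\phi_{n,s}(f(\boldsymbol t_1),\dots,f(\boldsymbol t_n))$ with arbitrary $\boldsymbol t_i\in[0,1)^s$ and arbitrary $\phi_{n,s}:\mathbb R^n\to\mathbb R$. For a normed function space $\mathcal H$, $e^{\mathrm{wor}}(A_{n,s},\mathcal H)=\sup_{f\in\mathcal H,\|f\|_{\mathcal H}\le1}|I(f)-A_{n,s}(f)|$ and $e(n,s,\mathcal H)=\inf_{A_{n,s}}e^{\mathrm{wor}}(A_{n,s},\mathcal H)$, the infimum being over all algorithms using $n$ function values. *)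

(* Defs.v *)
From HB Require Import structures.
From mathcomp Require Import all_boot all_order all_algebra.
From mathcomp Require Import archimedean complex.
From mathcomp Require Import all_classical all_reals all_analysis.
From mathcomp.analysis Require Import showcase.summability.

Set Implicit Arguments.
Unset Strict Implicit.
Unset Printing Implicit Defensive.

Import Order.TTheory GRing.Theory Num.Theory.
Import numFieldNormedType.Exports.

Local Open Scope classical_set_scope.
Local Open Scope ring_scope.

Notation Rn R s := (s.-tuple (measurableTypeR R)).

Section tuple_lebesgue.
Variable R : realType.

Definition cons_tup s (p : measurableTypeR R * Rn R s) : Rn R s.+1 :=
  [tuple of p.1 :: p.2].

Definition uncons_tup s (x : Rn R s.+1) : measurableTypeR R * Rn R s :=
  (thead x, [tuple of behead x]).

Lemma measurable_cons_tup s : measurable_fun [set: _] (@cons_tup s).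
Proof. exact: measurable_cons. Qed.

Lemma measurable_uncons_tup s : measurable_fun [set: _] (@uncons_tup s).
Proof.
apply: measurable_fun_pair; last exact: measurable_behead.
exact: (@measurable_tnth _ _ _ ord0).
Qed.

Lemma cons_tupK s : cancel (@cons_tup s) (@uncons_tup s).
Proof. by move=> [x t]; congr pair; apply/val_inj. Qed.

Section step.
Variables (s : nat) (m : {sigma_finite_measure set (Rn R s) -> \bar R}).

Definition lebesgue_cons : set (Rn R s.+1) -> \bar R :=
  pushforward (@lebesgue_measure R \x m)%E (@cons_tup s).

Let cons0 : lebesgue_cons set0 = 0%E.
Proof. by rewrite /lebesgue_cons /pushforward preimage_set0 measure0. Qed.

Let cons_ge0 A : (0 <= lebesgue_cons A)%E.
Proof. by rewrite /lebesgue_cons /pushforward measure_ge0. Qed.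

Let cons_sigma_additive : semi_sigma_additive lebesgue_cons.
Proof.
move=> F mF tF mUF; rewrite /lebesgue_cons /pushforward preimage_bigcup.
apply: measure_semi_sigma_additive.
- by move=> n; rewrite -[X in measurable X]setTI; exact: measurable_cons_tup.
- apply/trivIsetP => /= i j _ _ ij; rewrite -preimage_setI.
  by move/trivIsetP : tF => /(_ _ _ _ _ ij) ->//; rewrite preimage_set0.
- by rewrite -preimage_bigcup -[X in measurable X]setTI;
    exact: measurable_cons_tup.
Qed.

HB.instance Definition _ := isMeasure.Build _ _ _
  lebesgue_cons cons0 cons_ge0 cons_sigma_additive.

Let cons_sigma_finite : sigma_finite setT lebesgue_cons.
Proof.
have /sigma_finiteP[F [TF ndF Foo]] := sigma_finiteT (@lebesgue_measure R).
have /sigma_finiteP[G [TG ndG Goo]] := sigma_finiteT m.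
exists (fun n => @uncons_tup s @^-1` (F n `*` G n)).
  rewrite -preimage_bigcup (_ : \bigcup_n _ = setT) ?preimage_setT//.
  rewrite -subTset => -[x y] _.
  have [n _ Fnx] : (\bigcup_i F i) x by rewrite -TF.
  have [k _ Gky] : (\bigcup_i G i) y by rewrite -TG.
  exists (maxn n k) => //; split.
  - by move: x Fnx; exact/subsetPset/ndF/leq_maxl.
  - by move: y Gky; exact/subsetPset/ndG/leq_maxr.
move=> n; have [mF Fn] := Foo n; have [mG Gn] := Goo n; split.
  rewrite -[X in measurable X]setTI.
  by apply: measurable_uncons_tup => //; exact: measurableX.
rewrite /lebesgue_cons /pushforward -comp_preimage.
rewrite (_ : @uncons_tup s \o @cons_tup s = id) ?preimage_id//; last first.
  by apply/funext => x /=; rewrite cons_tupK.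
by rewrite product_measure1E// lte_mul_pinfty// ge0_fin_numE.
Qed.

HB.instance Definition _ :=
  Measure_isSigmaFinite.Build _ _ _ lebesgue_cons cons_sigma_finite.

End step.

Fixpoint lebesgue_tuple s : {sigma_finite_measure set (Rn R s) -> \bar R} :=
  match s with
  | 0%N => \d_ [tuple]
  | s'.+1 => lebesgue_cons (lebesgue_tuple s')
  end.

Lemma lebesgue_tuple_box s (A : 'I_s -> set (measurableTypeR R)) :
  (forall i, measurable (A i)) ->
  lebesgue_tuple s [set x | forall i, A i (tnth x i)] =
  (\prod_(i < s) lebesgue_measure (A i))%E.
Proof.
elim: s A => [|s IH] A mA.
  rewrite big_ord0 /= diracE mem_set//=; by case.
rewrite big_ord_recl /= /lebesgue_cons /pushforward.
have -> : @cons_tup s @^-1` [set x | forall i, A i (tnth x i)] =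
    A ord0 `*` [set x | forall i, A (lift ord0 i) (tnth x i)].
  apply/seteqP; split => [[x t] /= h|[x t] /= [h0 h] i].
    split; first exact: (h ord0).
    by move=> i; have := h (lift ord0 i); rewrite tnthS/=; congr (A _ (tnth _ _)); exact/val_inj.
  have [j ->|->//] := unliftP ord0 i.
  by have := h j; rewrite -[cons_tup _]/([tuple of x :: t]) tnthS.
set B := [set x : Rn R s | _].
have mB : measurable B.
  suff -> : B = \bigcap_(i in [set: 'I_s])
      (fun x => tnth x i) @^-1` A (lift ord0 i).
    apply: fin_bigcap_measurable => // i _.
    by rewrite -[X in measurable X]setTI; exact: measurable_tnth.
  by apply/seteqP; split => [x h i _|x h i]; [exact: h|exact: (h i I)].
by rewrite product_measure1E// (IH (fun i => A (lift ord0 i))).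
Qed.

End tuple_lebesgue.

Section walsh.
Variable R : realType.
Local Open Scope complex_scope.

Definition cube s : set (Rn R s) := [set x | forall j, 0 <= tnth x j < 1].

(* Digits are numbered from i = 1:  k = \sum_(i >= 1) ndigit b k i * b ^ (i-1)
   and, for x in [0,1[,  x = \sum_(i >= 1) rdigit b x i / b ^ i. *)
Definition ndigit (b k i : nat) : nat := (k %/ b ^ i.-1) %% b.
Definition rdigit (b : nat) (x : R) (i : nat) : nat :=
  Num.truncn (b%:R ^+ i * x) %% b.

(* The strict upper bound, for all n, rules out expansions that end with
   infinitely many digits b - 1. *)
Lemma rdigit_expansion (b : nat) (x : R) (n : nat) : (1 < b)%N -> 0 <= x < 1 ->
  0 <= x - \sum_(1 <= i < n.+1) (rdigit b x i)%:R / b%:R ^+ i < b%:R ^- n.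
Proof.
move=> b1 /andP[x0 x1]; have b0 : 0 < b%:R :> R by rewrite ltr0n ltnW.
have bn0 m : 0 < b%:R ^+ m :> R by rewrite exprn_gt0.
have -> : \sum_(1 <= i < n.+1) (rdigit b x i)%:R / b%:R ^+ i =
    (Num.truncn (b%:R ^+ n * x))%:R / b%:R ^+ n :> R.
  elim: n => [|n IH].
    rewrite big_geq// expr0 mul1r (truncn_def (n := 0)) ?mul0r//.
    by rewrite x0.
  rewrite big_nat_recr//= {}IH /rdigit.
  set N := Num.truncn (b%:R ^+ n.+1 * x).
  have NP : N%:R <= b%:R ^+ n.+1 * x < N.+1%:R.
    by apply: truncn_itv; rewrite mulr_ge0// ltW.
  have -> : Num.truncn (b%:R ^+ n * x) = (N %/ b)%N.
    apply: truncn_def; move: NP; rewrite exprS -mulrA => /andP[NL NU].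
    rewrite -(ler_pM2l b0) -(ltr_pM2l b0) -!natrM; apply/andP; split.
      by apply: le_trans NL; rewrite ler_nat mulnC leq_divM.
    apply: lt_le_trans NU _; rewrite ler_nat mulnC.
    by rewrite ltn_ceil// ltnW.
  rewrite [in RHS](divn_eq N b) natrD natrM mulrDl exprS; congr (_ + _).
  by rewrite invfM mulrA mulfK// gt_eqF.
have /andP[TL TU] : (Num.truncn (b%:R ^+ n * x))%:R <= b%:R ^+ n * x
    < (Num.truncn (b%:R ^+ n * x)).+1%:R.
  by apply: truncn_itv; rewrite mulr_ge0// ltW.
rewrite subr_ge0 ler_pdivrMr// [x * _]mulrC TL/=.
rewrite ltrBlDl -{2}[b%:R ^- n]mul1r -mulrDl ltr_pdivlMr// [x * _]mulrC.
by rewrite -natr1 in TU.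
Qed.

Definition omega (b : nat) : R[i] :=
  cos (2 * pi / b%:R) +i* sin (2 * pi / b%:R).

(* Since k < b ^ k, the digits of k of index i > k vanish. *)
Definition wal1 (b k : nat) (x : R) : R[i] :=
  omega b ^+ (\sum_(1 <= i < k.+1) ndigit b k i * rdigit b x i)%N.

Definition wal (b : nat) s (k : s.-tuple nat) (x : Rn R s) : R[i] :=
  \prod_(j < s) wal1 b (tnth k j) (tnth x j).

Definition cube_integral s (f : Rn R s -> R) : R :=
  \int[lebesgue_tuple R s]_(x in @cube s) f x.

Definition cube_cintegral s (g : Rn R s -> R[i]) : R[i] :=
  cube_integral (fun x => complex.Re (g x)) +i*
  cube_integral (fun x => complex.Im (g x)).

Definition walsh_coef (b : nat) s (f : Rn R s -> R) (k : s.-tuple nat) : R[i] :=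
  cube_cintegral (fun x => (f x)%:C * (wal b k x)^*).

Definition h (kappa : nat) : R := (kappa != 0%N)%:R.

Definition mu1 (b : nat) (a : R) (k : nat) : R :=
  \sum_(1 <= i < k.+1) (i%:R + a) * h (ndigit b k i).

(* Sequences indexed by the positive integers are functions on nat whose value
   at 0 is irrelevant, hence the shift with respect to the index in 'I_s. *)
Definition mu (b : nat) (a : nat -> R) s (k : s.-tuple nat) : R :=
  \sum_(j < s) mu1 b (a j.+1) (tnth k j).

Definition walsh_norm (b : nat) (a : nat -> R) s (f : Rn R s -> R) : \bar R :=
  ereal_sup [set (Normc.normc (walsh_coef b f k * (b%:R `^ mu b a k)%:C))%:E
            | k in [set: s.-tuple nat]].

(* Integrability is what makes the Walsh coefficients meaningful; the series
   over N_0^s is an unordered sum, i.e. it converges along the finite subsets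
   of the index set, which for complex families is absolute convergence.
   Values outside the cube are irrelevant. *)
Definition walsh_space (b : nat) (a : nat -> R) s : set (Rn R s -> R) :=
  [set f : Rn R s -> R | [/\ (lebesgue_tuple R s).-integrable (@cube s) (EFin \o f),
     forall x, cube x ->
       partial_sum (fun k => walsh_coef b f k * wal b k x) @ totally
         --> ((f x)%:C : R[i]^o) &
     (walsh_norm b a f < +oo)%E]].

Definition algorithm n s (t : n.-tuple (Rn R s)) (phi : n.-tuple R -> R)
  (f : Rn R s -> R) : R := phi (map_tuple f t).

Definition worst_case_error s (H : set (Rn R s -> R))
    (norm : (Rn R s -> R) -> \bar R) (A : (Rn R s -> R) -> R) : \bar R :=
  ereal_sup [set `|cube_integral f - A f|%:E
            | f in [set f | H f /\ (norm f <= 1)%E]].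

Definition minimal_error n s (H : set (Rn R s -> R))
    (norm : (Rn R s -> R) -> \bar R) : \bar R :=
  ereal_inf [set e | exists (t : n.-tuple (Rn R s)) (phi : n.-tuple R -> R),
    (forall i, cube (tnth t i)) /\
    e = worst_case_error H norm (algorithm t phi)].

Definition walsh_error (b : nat) (a : nat -> R) n s : \bar R :=
  minimal_error n (@walsh_space b a s) (@walsh_norm b a s).

End walsh.

(* Main.v *)
(** Upper bound.  By Chernoff's bound at most [D = b^(lam M) Z(lam)] indices [k]
    satisfy [mu(a;k) <= M], where [Z(lam) = sum_k b^(- lam mu(a;k))]
    factorizes over the digits of [k] and is at most
    [exp (b / (lam ln b) * sum_j b^(- lam a_j))].  The uniform rule on a fine
    grid integrates these [D] Walsh functions exactly; Caratheodory's theorem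
    thins it to a positive rule with [2 D] nodes, still exact on them.  Its error
    is the tail [sum_(mu > M) b^(- mu) <= b^(- M / 2) Z(1/2)].  Optimizing [lam]
    and [M] gives [exp (- c (ln n)^p)] as soon as
    [sum_j b^(- lam a_j) = O(lam^(- (2 - p) / (p - 1)))]; this holds with [p = 2]
    for fixed [s], and uniformly in [s] when [a_j >= g j^((p - 1) / (2 - p))].

    Lower bound.  If [n < b^(m s)], some elementary cell of side [b^(- m)]
    contains no node.  Its indicator is a Walsh polynomial over [k_j < b^m] whose
    coefficients all have the same modulus, so rescaling it to norm 1 leaves an
    integral of at least [b^(- max mu)], and no algorithm can tell the rescaled
    function from its opposite.  Letting [n] tend to infinity for fixed
    [s] bounds the constant of part 2 by [1 / (2 s ln b)]; taking [m] of order
    [s^((p - 1) / (2 - p))] turns (b) into the growth condition (a). *)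
Require Import Defs.
From mathcomp Require Import all_boot all_order all_algebra.
From mathcomp Require Import archimedean complex finmap.
From mathcomp Require Import all_classical all_reals all_analysis.
From mathcomp.analysis Require Import showcase.summability.
From mathcomp Require Import measurable_realfun ring lra zify.

Import Order.TTheory GRing.Theory Num.Theory.
Import numFieldNormedType.Exports.

Local Open Scope classical_set_scope.
Local Open Scope ring_scope.


(** * Digits and character sums *)

(* Digits are numbered from 0 here: [ndigit b k i.+1 = digit b k i]. *)
Definition digit (b g i : nat) : nat := ((g %/ b ^ i) %% b)%N.

Section digits.
Context {b : nat} (b1 : (1 < b)%N).

Let b0 : (0 < b)%N. Proof. exact: ltnW. Qed.

Lemma digit_lt g i : (digit b g i < b)%N.
Proof. exact: ltn_pmod. Qed.

Lemma digit_eq0 g i N : (g < b ^ N)%N -> (N <= i)%N -> digit b g i = 0%N.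
Proof.
move=> gN Ni; rewrite /digit divn_small ?mod0n//.
by apply: leq_trans gN _; rewrite leq_pexp2l.
Qed.

Lemma digitDl q r i N : (i < N)%N -> digit b (q * b ^ N + r) i = digit b r i.
Proof.
move=> iN; rewrite /digit -(subnKC iN) addSnnS expnD mulnCA expnS.
rewrite divnDl ?dvdn_mulr// mulKn ?expn_gt0 ?b0//.
by rewrite mulnCA -modnDml modnMr.
Qed.

Lemma digit_top q r N : (r < b ^ N)%N -> (q < b)%N -> digit b (q * b ^ N + r) N = q.
Proof.
by move=> rN qb; rewrite /digit divnMDl ?expn_gt0 ?b0// divn_small// addn0 modn_small.
Qed.

Lemma digit_inj N g g' : (g < b ^ N)%N -> (g' < b ^ N)%N ->
  (forall i, (i < N)%N -> digit b g i = digit b g' i) -> g = g'.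
Proof.
elim: N g g' => [|N IH] g g'; first by rewrite expn0 !ltnS !leqn0 => /eqP-> /eqP->.
move=> gN gN' H.
rewrite (divn_eq g b) (divn_eq g' b); congr (_ * _ + _)%N.
  apply: IH.
  - by rewrite ltn_divLR// mulnC -expnS.
  - by rewrite ltn_divLR// mulnC -expnS.
  by move=> i iN; have := H i.+1 iN; rewrite /digit expnS -!divnMA.
by have := H 0%N isT; rewrite /digit expn0 !divn1.
Qed.

(* The digit map is a bijection onto [0, b[^N: expand the product of sums. *)
Lemma sum_prod_digit {A : comPzSemiRingType} N (F : nat -> nat -> A) :
  \sum_(g < b ^ N) \prod_(i < N) F i (digit b g i) =
  \prod_(i < N) \sum_(d < b) F i d.
Proof.
elim: N => [|N IH].
  by rewrite big_ord0 expn0 big_ord1 big_ord0.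
rewrite big_ord_recr /= -IH mulr_sumr.
have -> : \sum_(g < b ^ N.+1) \prod_(i < N.+1) F i (digit b g i) =
    \sum_(0 <= g < b * b ^ N) \prod_(i < N.+1) F i (digit b g i).
  by rewrite -expnS big_mkord.
(* Cuts the range into [b] blocks of length [b ^ N]; the block number is the top digit. *)
rewrite big_nat_mul/= big_mkord; apply: eq_bigr => d _.
rewrite -{1}(add0n (d * b ^ N)%N) big_addn mulSn addnK big_mkord mulr_suml.
apply: eq_bigr => g _.
rewrite big_ord_recr/= addnC digit_top//; congr (_ * _).
by apply: eq_bigr => i _; rewrite digitDl.
Qed.

End digits.

Section omega.
Context {R : realType} {b : nat} (b1 : (1 < b)%N).
Local Open Scope complex_scope.

Let b0 : 0 < b%:R :> R. Proof. by rewrite ltr0n ltnW. Qed.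

Lemma omegaX n :
  omega R b ^+ n = cos (2 * pi / b%:R *+ n) +i* sin (2 * pi / b%:R *+ n).
Proof.
elim: n => [|n IH]; first by rewrite expr0 mulr0n cos0 sin0.
rewrite exprSr IH (mulrSr (2 * pi / b%:R)) cosD sinD /omega.
by apply/eqP; rewrite eq_complex/= !eqxx addrC eqxx.
Qed.

Lemma omegaXb : omega R b ^+ b = 1.
Proof.
by rewrite omegaX -mulr_natr divfK ?gt_eqF// mulrC mulr_natr cos2pi sin2pi.
Qed.

(** With [t = pi c / b] in []0, pi[], the equality [cos (2 t) = 1] would force [sin t = 0]. *)
Lemma omegaX_neq1 c : (0 < c < b)%N -> omega R b ^+ c != 1.
Proof.
move=> /andP[c0 cb]; rewrite omegaX; apply/negP => /eqP[+ _].
pose t : R := pi / b%:R *+ c.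
have -> : 2 * pi / b%:R *+ c = t + t by rewrite -mulrA mulr_natl mulrnAC mulr2n.
have t0 : 0 < t by rewrite /t pmulrn_lgt0// divr_gt0 ?pi_gt0.
have tpi : t < pi.
  by rewrite /t -mulrnAl ltr_pdivrMr// -mulr_natr ltr_pM2l ?pi_gt0// ltr_nat.
have s0 := @sin_gt0_pi R t (introT andP (conj t0 tpi)); have := cos2Dsin2 t.
rewrite cosD -!expr2 => h1 h2; have : 0 < sin t ^+ 2 by rewrite exprn_gt0.
by lra.
Qed.

Lemma omegaX_mod n : omega R b ^+ (n %% b) = omega R b ^+ n.
Proof. by rewrite {2}(divn_eq n b) exprD mulnC exprM omegaXb expr1n mul1r. Qed.

Lemma sum_omega d :
  \sum_(c < b) omega R b ^+ (d * c) = if (b %| d)%N then b%:R else 0.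
Proof.
under eq_bigr do rewrite exprM -omegaX_mod.
case: ifPn => bd.
  rewrite (eqP bd) expr0; under eq_bigr do rewrite expr1n.
  by rewrite sumr_const card_ord.
set z := omega R b ^+ _; have z1 : z - 1 != 0.
  rewrite subr_eq0; apply: omegaX_neq1.
  by rewrite lt0n bd/= ltn_pmod// ltnW.
apply: (mulfI z1); rewrite -subrX1 mulr0 /z -exprM mulnC exprM omegaXb.
by rewrite expr1n subrr.
Qed.

(** A natural exponent for the conjugate turns a product of a Walsh function with a conjugate one
    into a single power of [omega], the form treated by [sum_omega_digit]. *)
Lemma omega_conjX n : (omega R b ^+ n)^*%C = omega R b ^+ (b.-1 * n).
Proof.
have zz : omega R b * omega R b ^+ b.-1 = 1.
  by rewrite -exprS prednK ?omegaXb// ltnW.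
have z0 : omega R b != 0.
  by apply/eqP => z0; move: zz; rewrite z0 mul0r => /esym/eqP; rewrite oner_eq0.
have zc : omega R b * (omega R b)^*%C = 1.
  rewrite /omega /=; apply/eqP; rewrite eq_complex/=; apply/andP; split.
    by rewrite mulrN opprK -!expr2 cos2Dsin2.
  by rewrite mulrN mulrC addNr.
rewrite rmorphXn exprM; congr (_ ^+ _).
by apply: (mulfI z0); rewrite zz zc.
Qed.

Lemma normc_omegaX n : `|omega R b ^+ n| = 1.
Proof.
by rewrite normrX normc_def /omega/= cos2Dsin2 sqrtr1 expr1n.
Qed.

Lemma sum_omega_digit N (c : nat -> nat) :
  \sum_(g < b ^ N) omega R b ^+ (\sum_(i < N) c i * digit b g i)%N =
  if [forall i : 'I_N, (b %| c i)%N] then (b ^ N)%:R else 0.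
Proof.
under eq_bigr do rewrite expr_sum.
rewrite (sum_prod_digit b1 N (fun i d => omega R b ^+ (c i * d)%N)).
under eq_bigr do rewrite sum_omega.
case: ifPn => [/forallP h|/forallPn[i /negbTE h]].
  under eq_bigr do rewrite h.
  by rewrite prodr_const card_ord natrX.
by rewrite (bigD1 i)//= h mul0r.
Qed.

End omega.

(** * Walsh functions on grids *)

Section walsh_digits.
Context {R : realType} {b : nat} (b1 : (1 < b)%N).
Local Open Scope complex_scope.

Let bn0 N : 0 < b%:R ^+ N :> R.
Proof. by rewrite exprn_gt0// ltr0n ltnW. Qed.

(** [wal1] and [mu1] sum up to the index [k] itself; this trades that bound for a common [N], since
    both lie beyond the last nonzero digit. *)
Lemma big_digit {A : nmodType} (F : nat -> A) k N :
  (forall i, digit b k i = 0%N -> F i.+1 = 0) -> (k < b ^ N)%N ->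
  \sum_(1 <= i < k.+1) F i = \sum_(i < N) F i.+1.
Proof.
move=> F0 kN; rewrite big_add1/= -(big_mkord xpredT (fun i => F i.+1)).
have ext n : (n <= maxn k N)%N -> (k < b ^ n)%N ->
    \sum_(0 <= i < maxn k N) F i.+1 = \sum_(0 <= i < n) F i.+1.
  move=> nM kn; rewrite (big_cat_nat (leq0n n) nM)/= [X in _ + X]big_nat_cond.
  rewrite [X in _ + X]big1 ?addr0// => i /andP[/andP[ni _] _].
  by apply: F0; exact: (digit_eq0 b1 _ _ _ kn).
exact: etrans (esym (ext k (leq_maxl k N) (ltn_expl k b1))) (ext N (leq_maxr k N) kN).
Qed.

Lemma truncn_ltn (x : R) N : 0 <= x < 1 ->
  (Num.truncn (b%:R ^+ N * x) < b ^ N)%N.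
Proof.
move=> /andP[x0 x1]; rewrite -(ltr_nat R) natrX.
have /truncn_itv/andP[h _] := mulr_ge0 (ltW (bn0 N)) x0.
by apply: le_lt_trans h _; rewrite gtr_pMr.
Qed.

(** Makes the first [N] digits of [x] digits of one integer, the number of the cell of side
    [b ^ (- N)] that contains [x]. *)
Lemma truncn_div (x : R) N i : 0 <= x -> (i <= N)%N ->
  Num.truncn (b%:R ^+ i * x) = (Num.truncn (b%:R ^+ N * x) %/ b ^ (N - i))%N.
Proof.
move=> x0 iN; apply: truncn_def.
have /truncn_itv := mulr_ge0 (ltW (bn0 N)) x0.
set T := Num.truncn _ => /andP[TL TU].
have bNi : (0 < b ^ (N - i))%N by rewrite expn_gt0 ltnW.
have E : b%:R ^+ N * x = (b ^ (N - i))%:R * (b%:R ^+ i * x).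
  by rewrite mulrA natrX -exprD subnK.
rewrite -(ler_pM2l (_ : 0 < (b ^ (N - i))%:R)) ?ltr0n// -E.
rewrite -(ltr_pM2l (_ : 0 < (b ^ (N - i))%:R)) ?ltr0n// -E.
rewrite -!natrM; apply/andP; split.
  by apply: le_trans TL; rewrite ler_nat mulnC leq_divM.
by apply: lt_le_trans TU _; rewrite ler_nat mulnC ltn_ceil.
Qed.

Lemma truncn_grid N g : Num.truncn (b%:R ^+ N * (g%:R / b%:R ^+ N) : R) = g.
Proof. by rewrite mulrC divfK ?gt_eqF// natrK. Qed.

Lemma grid_itv N g : (g < b ^ N)%N -> 0 <= (g%:R / b%:R ^+ N : R) < 1.
Proof.
move=> gN; rewrite divr_ge0 ?(ltW (bn0 _))//=.
by rewrite ltr_pdivrMr// mul1r -natrX ltr_nat.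
Qed.

(** Digits of [x] run from the most significant one and digits of an integer from the least
    significant one, hence the reversed position [N.-1 - i]. *)
Lemma wal1E k N (x : R) : 0 <= x < 1 -> (k < b ^ N)%N ->
  wal1 b k x = omega R b ^+
   (\sum_(i < N)
     digit b k i * digit b (Num.truncn (b%:R ^+ N * x)) (N.-1 - i))%N.
Proof.
move=> /andP[x0 x1] kN; rewrite /wal1; congr (_ ^+ _).
rewrite (big_digit (fun i => ndigit b k i * rdigit b x i)%N k N _ kN); last first.
  by move=> i ki; rewrite [ndigit _ _ _]ki.
apply: eq_bigr => i _; congr (_ * _)%N; rewrite /rdigit /digit.
rewrite (@truncn_div x N i.+1)//.
by rewrite -subn1 -subnDA add1n.
Qed.

(** [b.-1] plays [-1] modulo [b], as in the exponent of a conjugate. *)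
Lemma eqmod_dvd x y : (x < b)%N -> (y < b)%N ->
  (b %| x + b.-1 * y)%N = (x == y).
Proof.
move=> xb yb; have b0 : (0 < b)%N by exact: ltnW.
apply/idP/eqP => [h|->]; last by rewrite -mulSn prednK// dvdn_mulr.
have : (x + b.-1 * y + y == y %[mod b])%N by rewrite -modnDml (eqP h).
by rewrite -addnA -mulSnr prednK// -modnDmr modnMr addn0 !modn_small// => /eqP.
Qed.

Lemma wal1_orth N k l : (k < b ^ N)%N -> (l < b ^ N)%N ->
  \sum_(g < b ^ N) wal1 b k (g%:R / b%:R ^+ N) *
    (wal1 b l (g%:R / b%:R ^+ N : R))^*%C =
  if k == l then (b ^ N)%:R else 0.
Proof.
move=> kN lN.
under eq_bigr => g _.
  rewrite !(wal1E _ N) ?grid_itv// truncn_grid omega_conjX// -exprD.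
  (* The reversal brings the digits of [g] into the order that [sum_omega_digit] expects. *)
  rewrite big_distrr -big_split/= (reindex_inj rev_ord_inj)/=.
  under eq_bigr => i _.
    have -> : (N.-1 - (N - i.+1) = i)%N by have := ltn_ord i; lia.
    rewrite mulnA -mulnDl; over.
  over.
rewrite (sum_omega_digit b1 N
  (fun i => digit b k (N - i.+1) + b.-1 * digit b l (N - i.+1))%N).
have -> // : [forall i : 'I_N,
    (b %| digit b k (N - i.+1) + b.-1 * digit b l (N - i.+1))%N] = (k == l).
apply/forallP/eqP => [h|-> i]; last by rewrite eqmod_dvd ?digit_lt.
apply: (digit_inj b1 N) => // i iN; apply/eqP; rewrite -eqmod_dvd ?digit_lt//.
have := h (rev_ord (Ordinal iN)).
by have -> : (N - (rev_ord (Ordinal iN)).+1 = i)%N by move=> /=; lia.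
Qed.

(** The same character sum with index and point exchanged; it expands the indicator of a cell into
    Walsh functions. *)
Lemma wal1_dual N (x y : R) : 0 <= x < 1 -> 0 <= y < 1 ->
  \sum_(k < b ^ N) wal1 b k x * (wal1 b k y)^*%C =
  if Num.truncn (b%:R ^+ N * x) == Num.truncn (b%:R ^+ N * y)
  then (b ^ N)%:R else 0.
Proof.
move=> x01 y01; set tx := Num.truncn _; set ty := Num.truncn _.
under eq_bigr => k _.
  rewrite !(wal1E _ N)// -/tx -/ty omega_conjX// -exprD.
  rewrite big_distrr -big_split/=.
  under eq_bigr => i _ do rewrite mulnCA -mulnDr mulnC.
  over.
rewrite (sum_omega_digit b1 N
  (fun i => digit b tx (N.-1 - i) + b.-1 * digit b ty (N.-1 - i))%N).
have -> // : [forall i : 'I_N,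
    (b %| digit b tx (N.-1 - i) + b.-1 * digit b ty (N.-1 - i))%N] = (tx == ty).
apply/forallP/eqP => [h|-> i]; last by rewrite eqmod_dvd ?digit_lt.
apply: (digit_inj b1 N); rewrite ?truncn_ltn// => i iN.
apply/eqP; rewrite -eqmod_dvd ?digit_lt//.
have := h (rev_ord (Ordinal iN)).
by have -> : (N.-1 - rev_ord (Ordinal iN) = i)%N by move=> /=; lia.
Qed.

End walsh_digits.


(** * Grids and elementary cells of the cube *)

Notation grid b s N := {ffun 'I_s -> 'I_(b ^ N)%N}.

Section grid.
Context {R : realType} {b : nat} (b1 : (1 < b)%N).
Local Open Scope complex_scope.

Let bn0 N : 0 < b%:R ^+ N :> R.
Proof. by rewrite exprn_gt0// ltr0n ltnW. Qed.

Definition grid_point {s N} (G : grid b s N) : Rn R s :=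
  [tuple (G j)%:R / b%:R ^+ N | j < s].

Definition grid_index {s N} (K : grid b s N) : s.-tuple nat :=
  [tuple (K j : nat) | j < s].

Definition cell {s} N (x : Rn R s) (j : 'I_s) : nat :=
  Num.truncn (b%:R ^+ N * tnth x j).

Lemma cube_grid_point s N (G : grid b s N) : @cube R s (grid_point G).
Proof. by move=> j; rewrite tnth_mktuple (grid_itv b1). Qed.

Lemma cell_grid_point s N (G : grid b s N) j : cell N (grid_point G) j = G j.
Proof. by rewrite /cell tnth_mktuple (truncn_grid b1). Qed.

Lemma cell_exists s N (x : Rn R s) : cube x ->
  exists G : grid b s N, forall j, cell N x j = G j.
Proof.
move=> x01; exists [ffun j => Ordinal (truncn_ltn b1 _ N (x01 j))] => j.
by rewrite ffunE.
Qed.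

Lemma grid_index_exists s N (k : s.-tuple nat) :
  (forall j, (tnth k j < b ^ N)%N) -> exists K : grid b s N, k = grid_index K.
Proof.
move=> kN; exists [ffun j => Ordinal (kN j)]; apply: eq_from_tnth => j.
by rewrite tnth_mktuple ffunE.
Qed.

Lemma grid_index_inj s N : injective (@grid_index s N).
Proof.
move=> K L KL; apply/ffunP => j; apply/val_inj.
by have := congr1 (fun k => tnth k j) KL; rewrite !tnth_mktuple.
Qed.

Lemma sum_grid_point {A : comPzSemiRingType} s N (F : 'I_s -> R -> A) :
  \sum_(G : grid b s N) \prod_(j < s) F j (tnth (grid_point G) j) =
  \prod_(j < s) \sum_(g < b ^ N) F j (g%:R / b%:R ^+ N).
Proof.
rewrite bigA_distr_bigA; apply: eq_bigr => G _; apply: eq_bigr => j _.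
by rewrite tnth_mktuple.
Qed.

Lemma sum_grid_index {A : comPzSemiRingType} s N (F : 'I_s -> nat -> A) :
  \sum_(K : grid b s N) \prod_(j < s) F j (tnth (grid_index K) j) =
  \prod_(j < s) \sum_(k < b ^ N) F j k.
Proof.
rewrite bigA_distr_bigA; apply: eq_bigr => G _; apply: eq_bigr => j _.
by rewrite tnth_mktuple.
Qed.

Lemma wal_orth s N (k l : s.-tuple nat) :
  (forall j, (tnth k j < b ^ N)%N) -> (forall j, (tnth l j < b ^ N)%N) ->
  \sum_(G : grid b s N)
    wal b k (grid_point G) * (wal b l (grid_point G) : R[i])^*%C =
  if k == l then ((b ^ N) ^ s)%:R else 0.
Proof.
move=> kN lN; under eq_bigr do rewrite rmorph_prod -big_split/=.
rewrite (sum_grid_point s N (fun j x => wal1 b (tnth k j) x *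
  (wal1 b (tnth l j) x : R[i])^*%C)).
under eq_bigr do rewrite (wal1_orth b1)//.
case: eqP => [->|kl].
  under eq_bigr do rewrite eqxx.
  by rewrite prodr_const card_ord -natrX.
have [j klj] : exists j, tnth k j != tnth l j.
  apply/existsP; apply: contra_notT kl => /existsPn h; apply: eq_from_tnth => j.
  by apply/eqP/negPn; exact: h.
by rewrite (bigD1 j)//= ifN ?mul0r.
Qed.

Lemma wal_dual s N (x y : Rn R s) : cube x -> cube y ->
  \sum_(K : grid b s N)
    wal b (grid_index K) x * (wal b (grid_index K) y : R[i])^*%C =
  if [forall j, cell N x j == cell N y j] then ((b ^ N) ^ s)%:R else 0.
Proof.
move=> x01 y01; under eq_bigr do rewrite rmorph_prod -big_split/=.
rewrite (sum_grid_index s N (fun j k => wal1 b k (tnth x j) *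
  (wal1 b k (tnth y j) : R[i])^*%C)).
under eq_bigr do rewrite (wal1_dual b1)//.
case: ifPn => [/forallP xy|/forallPn[j xy]].
  under eq_bigr => j _ do rewrite xy.
  by rewrite prodr_const card_ord -natrX.
by rewrite (bigD1 j)//= -/(cell N x j) -/(cell N y j) (negbTE xy) mul0r.
Qed.

(** The box form gives measurability and volume; within the cube this is a fibre of [cell]. *)
Definition cell_set {s N} (G : grid b s N) : set (Rn R s) :=
  [set x | forall j, tnth x j \in
     `[(G j)%:R / b%:R ^+ N, (G j).+1%:R / b%:R ^+ N[].

Lemma cell_setP s N (G : grid b s N) (x : Rn R s) : cube x ->
  cell_set G x <-> forall j, cell N x j = G j.
Proof.
move=> x01; split => xG j.
  apply: truncn_def; have := xG j.
  by rewrite in_itv/= ler_pdivrMr// ltr_pdivlMr// mulrC.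
rewrite in_itv/= ler_pdivrMr// ltr_pdivlMr// mulrC -xG.
by apply: truncn_itv; have /andP[x0 _] := x01 j; rewrite mulr_ge0// ltW.
Qed.

Lemma measurable_box s (A : 'I_s -> set (measurableTypeR R)) :
  (forall i, measurable (A i)) ->
  measurable [set x : Rn R s | forall i, A i (tnth x i)].
Proof.
move=> mA; have -> : [set x : Rn R s | forall i, A i (tnth x i)] =
    \bigcap_(i in [set: 'I_s]) (fun x => tnth x i) @^-1` A i.
  by apply/seteqP; split => [x h i _|x h i]; [exact: h|exact: (h i I)].
apply: fin_bigcap_measurable => // i _.
by rewrite -[X in measurable X]setTI; exact: measurable_tnth.
Qed.

Lemma measurable_cell_set s N (G : grid b s N) :
  measurable (cell_set G).
Proof.
apply: (measurable_box s (fun j =>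
  `[(G j)%:R / b%:R ^+ N, (G j).+1%:R / b%:R ^+ N[%classic)) => j.
exact: measurable_itv.
Qed.

Lemma measurable_cube s : measurable (@cube R s).
Proof.
have -> : @cube R s = [set x | forall j, `[0, 1[%classic (tnth x j)].
  by apply/seteqP; split => x xE j; have := xE j; rewrite /= in_itv.
exact: (measurable_box s (fun=> `[0, 1[%classic)).
Qed.

Lemma cell_set_cube s N (G : grid b s N) :
  cell_set G `<=` @cube R s.
Proof.
move=> x xG j; have := xG j; rewrite in_itv/= => /andP[h1 h2]; apply/andP; split.
  by apply: le_trans h1; rewrite divr_ge0// ltW.
by apply: lt_le_trans h2 _; rewrite ler_pdivrMr// mul1r -natrX ler_nat.
Qed.

Lemma lebesgue_cell_set s N (G : grid b s N) :
  lebesgue_tuple R s (cell_set G) = ((b%:R ^- N) ^+ s)%:E.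
Proof.
have -> := lebesgue_tuple_box (fun j =>
  measurable_itv `[(G j)%:R / b%:R ^+ N, (G j).+1%:R / b%:R ^+ N[ :
  measurable ([set` _] : set (measurableTypeR R))).
under eq_bigr => j _.
  rewrite lebesgue_measure_itv/= lte_fin ltr_pM2r ?invr_gt0// ltr_nat ltnSn.
  rewrite -EFinB -mulrBl -natrB// subSnn mul1r; over.
by rewrite prodEFin prodr_const card_ord.
Qed.

(** On the cube such an [f] is a finite combination of indicators of cells, all of volume
    [b ^ (- N s)], and each grid point lies in its own cell. *)
Lemma cell_integral s N (f : Rn R s -> R) :
  (forall x y, cube x -> cube y ->
     (forall j, cell N x j = cell N y j) -> f x = f y) ->
  (lebesgue_tuple R s).-integrable (@cube R s) (EFin \o f) /\
  cube_integral f = (b%:R ^- N) ^+ s *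
     \sum_(G : grid b s N) f (grid_point G).
Proof.
move=> fcell; set mu := lebesgue_tuple R s.
pose g x := (\sum_(G : grid b s N)
  (f (grid_point G))%:E * (\1_(cell_set G) x)%:E)%E.
have fg x : cube x -> (f x)%:E = g x.
  move=> x01; have [G xG] := cell_exists s N x x01.
  rewrite /g (bigD1 G)//= big1 ?adde0.
    rewrite indicE mem_set ?mule1; last exact/cell_setP.
    rewrite (fcell x (grid_point G))//; first exact: cube_grid_point.
    by move=> j; rewrite cell_grid_point.
  move=> H HG; rewrite indicE memNset ?mule0// => /(cell_setP _ _ _ _ x01) xH.
  move/eqP: HG; apply; apply/ffunP => j; apply/val_inj.
  by rewrite /= -xG -xH.
have muG (G : grid b s N) : mu (cell_set G `&` @cube R s) = ((b%:R ^- N) ^+ s)%:E.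
  by rewrite (setIidl (@cell_set_cube s N G)) lebesgue_cell_set.
have mC := measurable_cube s.
have intG (G : grid b s N) :
    mu.-integrable (@cube R s) (fun x => (\1_(cell_set G) x)%:E).
  apply/integrableP; split.
    apply/measurable_EFinP/measurable_funTS/measurable_indic.
    exact: measurable_cell_set.
  rewrite (eq_integral (fun x => (\1_(cell_set G) x)%:E)); last first.
    by move=> t _; rewrite gee0_abs// lee_fin.
  rewrite integral_indic//; last exact: measurable_cell_set.
  have muGoo : (mu (cell_set G `&` @cube R s) < +oo)%E by rewrite muG ltry.
  exact: muGoo.
have intfG (G : grid b s N) : mu.-integrable (@cube R s)
    (fun x => (f (grid_point G))%:E * (\1_(cell_set G) x)%:E)%E.
  exact: integrableZl.
split.
  apply: (eq_integrable mC g); first by move=> x /set_mem/fg.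
  exact: integrable_sum.
rewrite /cube_integral /Rintegral (eq_integral g); last by move=> x /set_mem/fg.
rewrite /g integral_sum//.
rewrite (eq_bigr (fun G => (f (grid_point G) * (b%:R ^- N) ^+ s)%:E)); last first.
  move=> G _; rewrite integralZl// EFinM; congr (_ * _)%E.
  rewrite integral_indic//; last exact: measurable_cell_set.
  exact: muG.
by rewrite sumEFin/= mulr_sumr; apply: eq_bigr => G _; rewrite mulrC.
Qed.

End grid.


(** * Walsh coefficients of Walsh polynomials *)

Section coefficients.
Context {R : realType} {b : nat} (b1 : (1 < b)%N).
Local Open Scope complex_scope.

Let bns_neq0 N s : ((b ^ N) ^ s)%:R != 0 :> R[i].
Proof. by rewrite pnatr_eq0 -lt0n !expn_gt0 (ltnW b1). Qed.

Lemma cell_cintegral s N (g : Rn R s -> R[i]) :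
  (forall x y, cube x -> cube y ->
     (forall j, cell (b := b) N x j = cell (b := b) N y j) -> g x = g y) ->
  cube_cintegral g = (((b ^ N) ^ s)%:R)^-1 *
     \sum_(G : grid b s N) g (grid_point G).
Proof.
move=> gcell.
have [_ reE] := cell_integral b1 s N (fun x => complex.Re (g x))
  (fun x y x01 y01 xy => congr1 (@complex.Re R) (gcell x y x01 y01 xy)).
have [_ imE] := cell_integral b1 s N (fun x => complex.Im (g x))
  (fun x y x01 y01 xy => congr1 (@complex.Im R) (gcell x y x01 y01 xy)).
rewrite /cube_cintegral reE imE.
have -> : (((b ^ N) ^ s)%:R)^-1 = ((b%:R ^- N) ^+ s)%:C :> R[i].
  by rewrite exprVn fmorphV/= -!natrX rmorph_nat.
set S := \sum_G g (grid_point G).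
have -> : \sum_(G : grid b s N) complex.Re (g (grid_point G)) = complex.Re S.
  by rewrite raddf_sum.
have -> : \sum_(G : grid b s N) complex.Im (g (grid_point G)) = complex.Im S.
  by rewrite raddf_sum.
by case: S => u v; apply/eqP; rewrite eq_complex/= !mul0r subr0 addr0 !eqxx.
Qed.

Lemma wal_cell s N (k : s.-tuple nat) (x y : Rn R s) :
  (forall j, (tnth k j < b ^ N)%N) -> cube x -> cube y ->
  (forall j, cell (b := b) N x j = cell (b := b) N y j) ->
  wal b k x = wal b k y.
Proof.
move=> kN x01 y01 xy; apply: eq_bigr => j _.
by rewrite !(wal1E b1 _ N)// -!/(cell N _ j) xy.
Qed.

Lemma grid_index_lt s N (K : grid b s N) j : (tnth (grid_index K) j < b ^ N)%N.
Proof. by rewrite tnth_mktuple. Qed.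

Lemma tuple_lt_exp s (k : s.-tuple nat) :
  exists N, forall j, (tnth k j < b ^ N)%N.
Proof.
exists (\max_(j < s) tnth k j) => j.
by apply: leq_ltn_trans (ltn_expl _ b1); rewrite (leq_bigmax_cond j).
Qed.

Lemma seq_tuple_lt_exp s (L : seq (s.-tuple nat)) :
  exists N, forall k, k \in L -> forall j, (tnth k j < b ^ N)%N.
Proof.
elim: L => [|k L [N IH]]; first by exists 0%N.
have [M kM] := tuple_lt_exp s k; exists (maxn N M) => l.
have lt_max i p : (p <= maxn N M)%N -> (i < b ^ p)%N -> (i < b ^ maxn N M)%N.
  by move=> pNM /leq_trans; apply; rewrite leq_pexp2l// ltnW.
rewrite inE => /orP[/eqP -> j|/IH lN j].
  by apply: (lt_max _ M) => //; exact: leq_maxr.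
by apply: (lt_max _ N) => //; exact: leq_maxl.
Qed.

(** On a grid fine enough for both [f] and [wal l] the integral is an average, and discrete
    orthogonality isolates [l]. The sum on the right has at most one term and is empty when [l] is
    not an index of the polynomial. *)
Lemma walsh_coef_poly s m (c : grid b s m -> R[i])
    (f : Rn R s -> R) (l : s.-tuple nat) :
  (forall x, cube x -> (f x)%:C = \sum_K c K * wal b (grid_index K) x) ->
  walsh_coef b f l = \sum_(K | grid_index K == l) c K.
Proof.
move=> fE; have [N0 lN0] := tuple_lt_exp s l.
pose N := maxn m N0.
have lt_N k n : (n <= N)%N -> (k < b ^ n)%N -> (k < b ^ N)%N.
  by move=> nN /leq_trans; apply; rewrite leq_pexp2l// ltnW.
have lN j : (tnth l j < b ^ N)%N by apply: (lt_N _ N0) => //; exact: leq_maxr.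
have KN (K : grid b s m) j : (tnth (grid_index K) j < b ^ N)%N.
  by apply: (lt_N _ m); [exact: leq_maxl|exact: grid_index_lt].
rewrite /walsh_coef (cell_cintegral s N); last first.
  move=> x y x01 y01 xy; rewrite !fE// (wal_cell _ N l x y)//.
  by under eq_bigr => K _ do rewrite (wal_cell _ N _ x y)//.
under eq_bigr => G _.
  rewrite fE; last exact: cube_grid_point.
  rewrite mulr_suml; under eq_bigr do rewrite -mulrA.
  over.
rewrite exchange_big/= [RHS]big_mkcond/= mulr_sumr; apply: eq_bigr => K _.
rewrite -mulr_sumr (wal_orth b1)//; case: ifP => _; last by rewrite !mulr0.
by rewrite mulrC mulfK.
Qed.

Lemma poly_in_walsh_space s m a (c : grid b s m -> R[i])
    (f : Rn R s -> R) :
  (forall x, cube x -> (f x)%:C = \sum_K c K * wal b (grid_index K) x) ->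
  (walsh_norm b a f < +oo)%E -> walsh_space b a f.
Proof.
move=> fE fnorm; split => //.
  apply: (cell_integral b1 s m f _).1 => x y x01 y01 xy.
  have [] // : (f x)%:C = (f y)%:C.
  rewrite !fE//; apply: eq_bigr => K _; congr (_ * _).
  by apply: (wal_cell _ m) => // j; exact: grid_index_lt.
move=> x x01; move=> P /(@nbhs_singleton R[i]^o) Pfx.
(* Partial sums over finite sets containing all these indices equal [f x] exactly. *)
exists [fset grid_index K | K : grid b s m]%fset => //= A BA.
suff E : partial_sum (fun k => walsh_coef b f k * wal b k x) A = (f x)%:C.
  by rewrite /preimage/= E.
rewrite /partial_sum -(big_seq_fsetE _ A xpredT (fun k => walsh_coef b f k * wal b k x)).
rewrite -(big_fset_incl _ BA)/=; last first.
  move=> k _ kB; rewrite (walsh_coef_poly s m c)// big1 ?mul0r// => K /eqP kK.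
  by case/negP: kB; apply/imfsetP; exists K.
rewrite big_imfset/=; last by move=> K L _ _; exact: grid_index_inj.
rewrite fE// -big_enum/= enumT; apply: eq_bigr => K _; congr (_ * _).
rewrite (walsh_coef_poly s m c)// (big_pred1 K)// => L.
by rewrite /= (inj_eq (grid_index_inj s m)).
Qed.

End coefficients.


(** * Lower bound: a bump supported in an empty cell *)

Section lower_bound.
Context {R : realType} {b : nat} (b1 : (1 < b)%N).
Local Open Scope complex_scope.

Let b0 : 0 < b%:R :> R. Proof. by rewrite ltr0n ltnW. Qed.

Lemma normc_Cnorm (z : R[i]) : (Normc.normc z)%:C = `|z|.
Proof. by []. Qed.

Lemma normc_wal s (k : s.-tuple nat) (x : Rn R s) : `|wal b k x| = 1.
Proof. by rewrite normr_prod big1// => j _; exact: normc_omegaX. Qed.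

Definition bump {s m} (r : R) (G0 : grid b s m) (x : Rn R s) : R :=
  if [forall j, cell (b := b) m x j == G0 j] then r else 0.

(** Dictated by the dual orthogonality [wal_dual]; all have modulus [|r| / b ^ (m s)]. *)
Definition bump_coef {s m} (r : R) (G0 : grid b s m)
    (K : grid b s m) : R[i] :=
  (r / ((b ^ m) ^ s)%:R)%:C * (wal b (grid_index K) (grid_point G0))^*%C.

Lemma bumpE s m r (G0 : grid b s m) (x : Rn R s) : cube x ->
  (bump r G0 x)%:C = \sum_K bump_coef r G0 K * wal b (grid_index K) x.
Proof.
move=> x01; under eq_bigr do rewrite -mulrA [(_)^*%C * _]mulrC.
rewrite -mulr_sumr (wal_dual b1)//; last exact: cube_grid_point.
have -> : [forall j, cell (b := b) m x j == cell (b := b) m (grid_point G0 : Rn R s) j]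
    = [forall j, cell (b := b) m x j == G0 j].
  by apply: eq_forallb => j; rewrite (cell_grid_point b1).
rewrite /bump; case: ifP => _; last by rewrite mulr0.
rewrite -(rmorph_nat (real_complex R)) -rmorphM/= divfK//.
by rewrite pnatr_eq0 -lt0n !expn_gt0 (ltnW b1).
Qed.

Lemma bump_integral s m r (G0 : grid b s m) :
  cube_integral (@bump s m r G0) = r / ((b ^ m) ^ s)%:R.
Proof.
have bump_cell (x y : Rn R s) : cube x -> cube y ->
    (forall j, cell (b := b) m x j = cell (b := b) m y j) ->
    bump r G0 x = bump r G0 y.
  by move=> _ _ xy; rewrite /bump; under eq_forallb => j do rewrite xy.
rewrite (cell_integral b1 s m _ bump_cell).2.
rewrite (bigD1 G0)//= big1 ?addr0; last first.
  move=> G GG0; rewrite /bump ifN//; apply: contra GG0 => /forallP h.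
  apply/eqP/ffunP => j; apply/val_inj; apply/eqP.
  by have := h j; rewrite (cell_grid_point b1).
rewrite /bump ifT; last by apply/forallP => j; rewrite (cell_grid_point b1).
by rewrite mulrC exprVn !natrX.
Qed.

(** The extreme case is that of [m] nonzero digits; with [max 0 a] in place of [a] every term is
    nonnegative, so a zero digit also respects the bound. *)
Lemma mu1_le (a : R) m k : (k < b ^ m)%N ->
  mu1 b a k <= (m * m.+1)%:R / 2 + m%:R * Num.max 0 a.
Proof.
move=> km; rewrite /mu1 (big_digit b1
  (fun i => (i%:R + a) * h R (ndigit b k i)) _ m)//; last first.
  by move=> i ki; rewrite /h [ndigit _ _ _]ki eqxx mulr0.
have -> : (m * m.+1)%:R / 2 + m%:R * Num.max 0 a =
    \sum_(i < m) (i.+1%:R + Num.max 0 a) :> R.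
  rewrite big_split/= sumr_const card_ord -[Num.max 0 a *+ m]mulr_natl; congr (_ + _).
  elim: m {km} => [|m IH]; first by rewrite big_ord0 mul0n mul0r.
  by rewrite big_ord_recr/= -IH !natrM -!natr1; field.
apply: ler_sum => i _; rewrite /h; case: (ndigit _ _ _ != _) => /=.
  by rewrite mulr1 lerD2l le_max lexx orbT.
by rewrite mulr0 addr_ge0// le_max lexx.
Qed.

Lemma mu_le s (a : nat -> R) m (K : grid b s m) :
  mu b a (grid_index K) <=
    s%:R * ((m * m.+1)%:R / 2) + m%:R * \sum_(j < s) Num.max 0 (a j.+1).
Proof.
have -> : s%:R * ((m * m.+1)%:R / 2) + m%:R * \sum_(j < s) Num.max 0 (a j.+1)
    = \sum_(j < s) ((m * m.+1)%:R / 2 + m%:R * Num.max 0 (a j.+1)) :> R.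
  by rewrite big_split/= sumr_const card_ord mulr_natl mulr_sumr.
by apply: ler_sum => j _; apply: mu1_le; exact: grid_index_lt.
Qed.

Lemma walsh_error_lower s (a : nat -> R) n m : (n < b ^ (m * s))%N ->
  ((b%:R `^ (- (s%:R * ((m * m.+1)%:R / 2) +
                m%:R * \sum_(j < s) Num.max 0 (a j.+1))))%:E
   <= walsh_error b a n s)%E.
Proof.
set T := _ + _ => nb; apply: le_ereal_inf_tmp => _ [t [phi [t01 ->]]].
have [G0 G0t] : exists G0 : grid b s m,
    forall i, ~~ [forall j, cell (b := b) m (tnth t i) j == G0 j].
  have [G Gt] : exists G : 'I_n -> grid b s m,
      forall i j, cell (b := b) m (tnth t i) j = G i j.
    exists (fun i => projT1 (cid (cell_exists b1 s m _ (t01 i)))) => i.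
    exact: projT2 (cid (cell_exists b1 s m _ (t01 i))).
  (* Pigeonhole: the [n] nodes occupy at most [n < b ^ (m s)] cells. *)
  have : ~~ [forall G0, G0 \in codom G].
    apply/negP => /forallP h.
    have : (#|{: grid b s m}| <= #|codom G|)%N.
      by apply: subset_leq_card; apply/fintype.subsetP => G0 _; exact: h.
    rewrite card_ffun !card_ord -expnM leqNgt => /negP; apply.
    apply: leq_ltn_trans nb; rewrite (leq_trans (card_size _))//.
    by rewrite size_codom card_ord.
  case/forallPn => G0 hG0; exists G0 => i; apply: contra hG0 => /forallP h.
  apply/codomP; exists i; apply/ffunP => j; apply/val_inj => /=.
  by have /eqP := h j; rewrite Gt.
(* The coefficients have modulus [|r| / b ^ (m s)] and [mu <= T], so this size of [r] is just what
   keeps the norm at most 1. *)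
have bump_ball r : `|r| <= b%:R `^ (- T) * ((b ^ m) ^ s)%:R ->
    walsh_space b a (@bump s m r G0) /\ (walsh_norm b a (@bump s m r G0) <= 1)%E.
  move=> rT; suff nb1 : (walsh_norm b a (@bump s m r G0) <= 1)%E.
    split=> //; apply: (poly_in_walsh_space b1 s m a (bump_coef r G0)).
      by move=> x; exact: bumpE.
    by apply: le_lt_trans nb1 _; rewrite ltry.
  apply: ge_ereal_sup => _ [k _ <-]; rewrite lee_fin -lecR normc_Cnorm normrM.
  rewrite (walsh_coef_poly b1 s m (bump_coef r G0))//; last first.
    by move=> x; exact: bumpE.
  have [[K <-]|noK] :=
    pselect (exists K : grid b s m, grid_index K = k); last first.
    rewrite big_pred0 ?normr0 ?mul0r ?ler01// => K; apply/eqP => Kk.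
    by apply: noK; exists K.
  rewrite (big_pred1 K); last by move=> L; rewrite /= (inj_eq (grid_index_inj s m)).
  rewrite /bump_coef normrM normcJ normc_wal mulr1 !normc_def/= expr0n/= !addr0.
  rewrite !sqrtr_sqr -rmorphM lecR normrM normfV normr_nat.
  rewrite (ger0_norm (powR_ge0 _ _)).
  rewrite mulrAC ler_pdivrMr ?ltr0n ?expn_gt0 ?expn_gt0 ?(ltnW b1)// mul1r.
  apply: le_trans (ler_wpM2r (powR_ge0 _ _) rT) _.
  rewrite mulrAC -powRD; last by rewrite (gt_eqF b0) implybT.
  rewrite ler_piMl //.
  rewrite -[leRHS](powRr0 b%:R) ler_powR ?ler1n ?(ltnW b1)//.
  by rewrite addrC subr_le0 mu_le.
pose r := b%:R `^ (- T) * ((b ^ m) ^ s)%:R : R.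
have r0 : 0 <= r by rewrite mulr_ge0 ?powR_ge0.
have rI : r / ((b ^ m) ^ s)%:R = b%:R `^ (- T).
  by rewrite mulfK// pnatr_eq0 -lt0n !expn_gt0 (ltnW b1).
(* All bumps vanish at the nodes, so the algorithm returns one and the same value [u] for all of
   them. *)
have alg r' : algorithm t phi (@bump s m r' G0) = phi [tuple 0 | i < n].
  rewrite /algorithm; congr phi; apply: eq_from_tnth => i.
  by rewrite tnth_map tnth_mktuple /bump (negbTE (G0t i)).
set u := phi _ in alg.
have err r' : `|r'| <= r -> 
    (`|r' / ((b ^ m) ^ s)%:R - u|%:E <=
      worst_case_error (@walsh_space R b a s) (@walsh_norm R b a s) (algorithm t phi))%E.
  move=> r'r; apply: ereal_sup_ubound; exists (@bump s m r' G0).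
    exact: bump_ball.
  by rewrite bump_integral alg.
(* The bump whose integral has the sign opposite to [u] is missed by at least [b ^ (- T)]. *)
have [u0|u0] := leP u 0.
  apply: le_trans (err r _); last by rewrite ger0_norm.
  by rewrite lee_fin rI (le_trans _ (ler_norm _))// lerBrDr gerDl.
apply: le_trans (err (- r) _); last by rewrite normrN ger0_norm.
rewrite lee_fin mulNr rI -opprD normrN (le_trans _ (ler_norm _))//.
by rewrite lerDl ltW.
Qed.

End lower_bound.


(** * Upper bound: positive cubature *)

Section caratheodory.
Context {R : realFieldType} {T : finType} {d : nat} (v : T -> 'rV[R]_d).

(** A nonzero vector in the kernel of the matrix with rows [v x], [x] in [S], up to a change of sign
    that makes some coefficient positive. *)
Lemma linear_dependence (S : {set T}) : (d < #|S|)%N ->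
  exists u : T -> R, [/\ exists x, 0 < u x, forall x, x \notin S -> u x = 0
    & \sum_x u x *: v x = 0].
Proof.
move=> dS; have /card_gt0P[x0 x0S] : (0 < #|S|)%N by exact: leq_ltn_trans dS.
pose A : 'M[R]_(#|S|, d) := \matrix_(i < #|S|) v (enum_val i).
have : kermx A != 0.
  rewrite -mxrank_eq0 mxrank_ker subn_eq0 -ltnNge.
  by apply: leq_ltn_trans dS; exact: rank_leq_col.
case/rowV0Pn => y /sub_kermxP yA y0.
pose u x := if x \in S then y 0 (enum_rank_in x0S x) else 0.
have uv : \sum_x u x *: v x = 0.
  rewrite (bigID (mem S))/= [X in _ + X]big1 ?addr0; last first.
    by move=> x /negbTE xS; rewrite /u xS scale0r.
  rewrite big_enum_val -[RHS]yA mulmx_sum_row; apply: eq_bigr => i _.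
  by rewrite rowK /u enum_valP enum_valK_in.
have [i yi] : exists i, y 0 i != 0.
  apply/existsP; apply: contraR y0 => /existsPn h; apply/eqP/rowP => i.
  by rewrite mxE; apply/eqP/negPn; exact: h.
have ui : u (enum_val i) = y 0 i by rewrite /u enum_valP enum_valK_in.
have [y_gt0|y_le0] := ltP 0 (y 0 i).
  exists u; split => //; first by exists (enum_val i); rewrite ui.
  by move=> x /negbTE xS; rewrite /u xS.
exists (fun x => - u x); split.
- by exists (enum_val i); rewrite ui oppr_gt0 lt_neqAle yi.
- by move=> x /negbTE xS; rewrite /u xS oppr0.
- by under eq_bigr do rewrite scaleNr; rewrite sumrN uv oppr0.
Qed.

(** Induction on the size of the support. While it exceeds [d], subtract the multiple of a linear
    dependence given by the least ratio [w x / u x]: the weights stay nonnegative and the minimizer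
    leaves the support. *)
Lemma caratheodory (w : T -> R) : (forall x, 0 <= w x) ->
  exists w' : T -> R, [/\ forall x, 0 <= w' x, (#|[set x | w' x != 0%R]%SET| <= d)%N
    & \sum_x w' x *: v x = \sum_x w x *: v x].
Proof.
have [n] := ubnP #|[set x | w x != 0]%SET|; elim: n w => // n IH w wn w0.
have [|dw] := leqP #|[set x | w x != 0]%SET| d; first by exists w.
have [u [[x0 ux0] uS uv]] := linear_dependence _ dw.
pose x1 := [arg min_(x < x0 | 0 < u x) (w x / u x)]%O.
have [ux1 x1min] : 0 < u x1 /\ forall x, 0 < u x -> w x1 / u x1 <= w x / u x.
  by rewrite /x1; case: arg_minP => // i ui mini; split.
pose t := w x1 / u x1; pose w' x := w x - t * u x.
have t0 : 0 <= t by rewrite divr_ge0// ltW.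
have w'0 x : 0 <= w' x.
  rewrite subr_ge0; have [ux|ux] := ltP 0 (u x).
    by rewrite -ler_pdivlMr// x1min.
  by apply: le_trans (w0 x); rewrite mulr_ge0_le0.
have w'x1 : w' x1 = 0 by rewrite /w' /t divfK ?gt_eqF// subrr.
have sub : [set x | w' x != 0]%SET \proper [set x | w x != 0]%SET.
  apply/properP; split; last first.
    exists x1; rewrite !inE ?w'x1 ?eqxx//; apply/negP => /eqP wx1.
    have := uS x1; rewrite inE wx1 eqxx => /(_ isT) u0.
    by rewrite u0 ltxx in ux1.
  apply/fintype.subsetP => x; rewrite !inE; apply: contra => /eqP wx.
  by have := uS x; rewrite /w' inE wx eqxx => /(_ isT) ->; rewrite mulr0 subr0.
have [|w'' [w''0 w''d w''v]] := IH w' _ w'0.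
  exact: leq_trans (proper_card sub) _.
exists w''; split => //; rewrite w''v.
under eq_bigr do rewrite /w' scalerBl -scalerA.
by rewrite sumrB -scaler_sumr uv scaler0 subr0.
Qed.

End caratheodory.


(** * Thinned cubature rules and their worst-case error *)

Section cubature.
Context {R : realType} {b : nat} (b1 : (1 < b)%N).
Local Open Scope complex_scope.

Let bns_neq0 N s : ((b ^ N) ^ s)%:R != 0 :> R[i].
Proof. by rewrite pnatr_eq0 -lt0n !expn_gt0 (ltnW b1). Qed.

Definition zero_index s : s.-tuple nat := [tuple 0%N | _ < s].

Lemma wal0 s (x : Rn R s) : wal b (zero_index s) x = 1.
Proof.
by apply: big1 => j _; rewrite tnth_mktuple /wal1 big_geq// expr0.
Qed.

Lemma sum_wal_grid s N (k : s.-tuple nat) : (forall j, (tnth k j < b ^ N)%N) ->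
  \sum_(G : grid b s N) wal b k (grid_point G : Rn R s) =
  if k == zero_index s then ((b ^ N) ^ s)%:R else 0.
Proof.
move=> kN; rewrite -(wal_orth b1)//; last first.
  by move=> j; rewrite tnth_mktuple expn_gt0 (ltnW b1).
by apply: eq_bigr => G _; rewrite wal0 rmorph1 mulr1.
Qed.

Lemma cubature s n (L : seq (s.-tuple nat)) : (2 * size L <= n)%N ->
  exists (t : n.-tuple (Rn R s)) (c : 'I_n -> R),
  [/\ forall i, cube (tnth t i), forall i, 0 <= c i &
      forall k, k \in L ->
        \sum_i (c i)%:C * wal b k (tnth t i) = (k == zero_index s)%:R].
Proof.
move=> Ln.
have [N LN] := seq_tuple_lt_exp b1 s L.
pose u (i : 'I_(size L)) (G : grid b s N) : R[i] :=
  wal b (tnth (in_tuple L) i) (grid_point G).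
(* Real and imaginary parts are separate real constraints, whence dimension [2 * size L]. *)
pose v (G : grid b s N) : 'rV[R]_(size L + size L) :=
  row_mx (\row_i complex.Re (u i G)) (\row_i complex.Im (u i G)).
pose w0 : R := (((b ^ N) ^ s)%:R)^-1.
have w0_ge0 (G : grid b s N) : 0 <= w0 by rewrite invr_ge0.
have [w [w_ge0 w_card wE]] := caratheodory v (fun=> w0) w0_ge0.
pose supp := [set G | w G != 0]%SET; pose e := enum supp.
pose G0 : grid b s N :=
  [ffun=> Ordinal (ltac:(by rewrite expn_gt0 (ltnW b1)) : 0 < b ^ N)%N].
have en : (size e <= n)%N.
  by rewrite -cardE (leq_trans w_card)// addnn -mul2n.
(* When the support has fewer than [n] points, the list of nodes is padded with the default [G0],
   taken with weight 0. *)
exists [tuple grid_point (nth G0 e i) | i < n].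
exists (fun i => if (i < size e)%N then w (nth G0 e i) else 0).
split => [i|i|k kL]; first by rewrite tnth_mktuple; exact: cube_grid_point.
  by case: ifP.
rewrite (eq_bigr (fun i : 'I_n => if (i < size e)%N then
    (w (nth G0 e i))%:C * wal b k (grid_point (nth G0 e i) : Rn R s) else 0)); last first.
  by move=> i _; rewrite tnth_mktuple; case: ifP; rewrite ?mul0r.
rewrite -big_mkcond/= -(big_ord_widen _
  (fun i => (w (nth G0 e i))%:C * wal b k (grid_point (nth G0 e i) : Rn R s)) en).
rewrite -(big_mkord xpredT
  (fun i => (w (nth G0 e i))%:C * wal b k (grid_point (nth G0 e i) : Rn R s))).
rewrite -(big_nth G0 xpredT (fun G => (w G)%:C * wal b k (grid_point G : Rn R s))).
rewrite big_enum/=.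
have -> : \sum_(G in supp) (w G)%:C * wal b k (grid_point G : Rn R s) =
    \sum_G (w G)%:C * wal b k (grid_point G : Rn R s).
  rewrite [RHS](bigID (mem supp))/= [X in _ + X]big1 ?addr0// => G.
  by rewrite inE negbK => /eqP ->; rewrite mul0r.
transitivity (\sum_(G : grid b s N) w0%:C * wal b k (grid_point G)); last first.
  rewrite -mulr_sumr sum_wal_grid; last exact: LN.
  case: ifP => _; last by rewrite mulr0.
  by rewrite /w0 fmorphV/= rmorph_nat mulVf.
have [i ki] : exists i, k = tnth (in_tuple L) i by apply/tnthP.
have re z x : complex.Re (z%:C * x) = z * complex.Re x :> R.
  by case: x => x1 x2 /=; rewrite mul0r subr0.
have im z x : complex.Im (z%:C * x) = z * complex.Im x :> R.
  by case: x => x1 x2 /=; rewrite mul0r addr0.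
have reE : \sum_G w G * complex.Re (u i G) = \sum_G w0 * complex.Re (u i G).
  have := congr1 (fun r : 'rV[R]_(size L + size L) => r 0 (lshift _ i)) wE.
  rewrite !summxE; under eq_bigr do rewrite mxE row_mxEl mxE.
  by under [X in _ = X -> _]eq_bigr do rewrite mxE row_mxEl mxE.
have imE : \sum_G w G * complex.Im (u i G) = \sum_G w0 * complex.Im (u i G).
  have := congr1 (fun r : 'rV[R]_(size L + size L) => r 0 (rshift _ i)) wE.
  rewrite !summxE; under eq_bigr do rewrite mxE row_mxEr mxE.
  by under [X in _ = X -> _]eq_bigr do rewrite mxE row_mxEr mxE.
apply/eqP; rewrite eq_complex; apply/andP; split; apply/eqP.
  rewrite !raddf_sum ki; transitivity (\sum_G w G * complex.Re (u i G)).
    by apply: eq_bigr => G _; exact: re.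
  by rewrite reE; apply: eq_bigr => G _; exact/esym/re.
rewrite !raddf_sum ki; transitivity (\sum_G w G * complex.Im (u i G)).
  by apply: eq_bigr => G _; exact: im.
by rewrite imE; apply: eq_bigr => G _; exact/esym/im.
Qed.

Lemma walsh_coef0 s (f : Rn R s -> R) :
  walsh_coef b f (zero_index s) = (cube_integral f)%:C.
Proof.
rewrite /walsh_coef /cube_cintegral; apply/eqP; rewrite eq_complex/=.
apply/andP; split; apply/eqP.
  congr cube_integral; apply/funext => x.
  by rewrite wal0 rmorph1 mulr1.
rewrite /cube_integral/Rintegral integral0_eq// => x _.
by rewrite wal0 rmorph1 mulr1.
Qed.

Lemma walsh_coef_le s (a : nat -> R) (f : Rn R s -> R) k :
  (walsh_norm b a f <= 1)%E -> `|walsh_coef b f k| <= (b%:R `^ (- mu b a k))%:C.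
Proof.
move=> f1.
have : ((Normc.normc (walsh_coef b f k * (b%:R `^ mu b a k)%:C))%:E <= 1%:E)%E.
  by apply: le_trans f1; apply: ereal_sup_ubound; exists k.
have bmu : 0 < b%:R `^ mu b a k :> R by rewrite powR_gt0// ltr0n ltnW.
rewrite lee_fin -lecR normc_Cnorm normrM => h.
rewrite powRN fmorphV/= -[leRHS]mul1r ler_pdivlMr ?ltcR//.
by rewrite (ger0_norm (ltW _ : 0 <= (b%:R `^ mu b a k)%:C)) ?ltcR in h.
Qed.

(** The rule is exact on [L], so only the Walsh series outside [L] contributes to the error. The
    tail is controlled through finite sums, uniformly in [A]. *)
Lemma walsh_error_upper s n (a : nat -> R) (L : seq (s.-tuple nat)) (eps : R) :
  uniq L -> zero_index s \in L -> (2 * size L <= n)%N ->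
  (forall A : {fset s.-tuple nat},
    \sum_(k <- A | k \notin L) b%:R `^ (- mu b a k) <= eps) ->
  (walsh_error b a n s <= eps%:E)%E.
Proof.
move=> uL zL Ln tail; have [t [c [t01 c0 cL]]] := cubature s n L Ln.
apply: ge_ereal_inf.
exists (worst_case_error (@walsh_space R b a s) (@walsh_norm R b a s)
  (algorithm t (fun y => \sum_i c i * tnth y i))); first by exists t; eexists.
apply: ge_ereal_sup => _ [f [[_ fcvg _] f1] <-]; rewrite lee_fin.
apply/ler_addgt0Pl => d d0.
pose S (A : {fset s.-tuple nat}) (x : Rn R s) :=
  \sum_(k <- A) walsh_coef b f k * wal b k x.
(* There are finitely many nodes, so pointwise convergence yields one partial sum that is [d]-close
   to [f] at all of them. *)
have [A [LA At]] : exists A : {fset s.-tuple nat}, {subset L <= A} /\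
    forall i, `|S A (tnth t i) - (f (tnth t i))%:C| <= d%:C.
  have near i : exists B : {fset s.-tuple nat},
      forall A : {fset s.-tuple nat}, (B `<=` A)%fset ->
      `|S A (tnth t i) - (f (tnth t i))%:C| <= d%:C.
    have dC : 0 < d%:C by rewrite ltcR.
    have [B _ HB] := fcvg _ (t01 i) _ (@nbhsx_ballx _ R[i]^o (f (tnth t i))%:C _ dC).
    exists B => A BA; have := HB A BA.
    rewrite /preimage/= /ball/= /partial_sum -(big_seq_fsetE _ A xpredT
      (fun k => walsh_coef b f k * wal b k (tnth t i))).
    by rewrite distrC => /ltW.
  pose B i := projT1 (cid (near i)).
  exists ([fset k | k in L] `|` \bigcup_(i <- enum 'I_n) B i)%fset; split.
    by move=> k kL; rewrite in_fsetU; apply/orP; left; rewrite in_imfset.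
  move=> i; apply: (projT2 (cid (near i))).
  apply: fsubset_trans (fsubsetUr _ _).
  by apply: bigfcup_sup => //; rewrite mem_enum.
have sumc : \sum_i c i = 1.
  have := cL _ zL; rewrite eqxx; under eq_bigr do rewrite wal0 mulr1.
  by rewrite -rmorph_sum => -[].
(* The value of the rule on [wal k], of modulus at most 1 because the weights are nonnegative with
   sum 1. *)
pose q k : R[i] := \sum_i (c i)%:C * wal b k (tnth t i).
have q1 k : `|q k| <= 1.
  apply: le_trans (ler_norm_sum _ _ _) _.
  rewrite (eq_bigr (fun i => (c i)%:C)); first by rewrite -rmorph_sum sumc.
  by move=> i _; rewrite normrM normc_wal mulr1 ger0_norm// lecR.
have QE : \sum_i (c i)%:C * S A (tnth t i) = (cube_integral f)%:C +
    \sum_(k <- A | k \notin L) walsh_coef b f k * q k.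
  under eq_bigr => i _ do (rewrite mulr_sumr; under eq_bigr do rewrite mulrCA).
  rewrite exchange_big/=; under eq_bigr do rewrite -mulr_sumr -/(q _).
  rewrite (bigID (fun k => k \in L))/=; congr (_ + _).
  rewrite big_mkcond/= (bigD1_seq (zero_index s)) ?LA ?fset_uniq//= zL.
  rewrite /q cL// eqxx mulr1 walsh_coef0 big1 ?addr0// => k /negbTE k0.
  by case: ifPn => // kL; rewrite -/(q k) /q cL// k0 mulr0.
rewrite -lecR.
have -> : `|cube_integral f - algorithm t (fun y => \sum_i c i * tnth y i) f|%:C =
    `|(cube_integral f)%:C - \sum_i (c i)%:C * (f (tnth t i))%:C|.
  rewrite /algorithm; under eq_bigr do rewrite tnth_map.
  under [in RHS]eq_bigr do rewrite -rmorphM.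
  rewrite -rmorph_sum -rmorphB/= normc_def/= expr0n/= addr0 sqrtr_sqr.
  by [].
(* The error is the rule applied to the approximation error, at most [d], minus the tail outside
   [L]. *)
have -> : (cube_integral f)%:C - \sum_i (c i)%:C * (f (tnth t i))%:C =
    \sum_i (c i)%:C * (S A (tnth t i) - (f (tnth t i))%:C) -
    \sum_(k <- A | k \notin L) walsh_coef b f k * q k.
  under [in RHS]eq_bigr do rewrite mulrBr.
  by rewrite sumrB QE; ring.
apply: le_trans (ler_normB _ _) _; rewrite rmorphD/=; apply: lerD.
  apply: le_trans (ler_norm_sum _ _ _) _.
  apply: (@le_trans _ _ (\sum_i (c i)%:C * d%:C)).
    apply: ler_sum => i _; rewrite normrM ger0_norm ?lecR//.
    by apply: ler_wpM2l (At i); rewrite lecR.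
  by rewrite -mulr_suml -rmorph_sum sumc mul1r.
apply: le_trans (ler_norm_sum _ _ _) _.
apply: (@le_trans _ _ (\sum_(k <- A | k \notin L) (b%:R `^ (- mu b a k))%:C)).
  apply: ler_sum => k _; rewrite normrM -[leRHS]mulr1.
  by apply: ler_pM => //; exact: walsh_coef_le.
by rewrite -rmorph_sum lecR.
Qed.

End cubature.


(** * Counting indices of low weight *)

Section weight_sums.
Context {R : realType} {b : nat} (b1 : (1 < b)%N).

Let b0 : 0 < b%:R :> R. Proof. by rewrite ltr0n ltnW. Qed.

Let lnb0 : 0 < ln (b%:R : R). Proof. by rewrite ln_gt0// ltr1n. Qed.

Let powbD (x y : R) : b%:R `^ (x + y) = b%:R `^ x * b%:R `^ y.
Proof. by rewrite powRD// (gt_eqF b0) implybT. Qed.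

Let powb_gt0 (x : R) : 0 < b%:R `^ x.
Proof. exact: powR_gt0. Qed.

(** From [b ^ lam >= 1 + lam ln b], each term times [lam ln b] is at most [y i - y i.+1], and these
    differences telescope. *)
Lemma geometric_le (lam : R) N : 0 < lam ->
  \sum_(i < N) b%:R `^ (- (lam * i.+1%:R)) <= (lam * ln b%:R)^-1.
Proof.
move=> l0; have L0 : 0 < lam * ln b%:R by rewrite mulr_gt0.
rewrite -[leRHS]mul1r ler_pdivlMr// mulr_suml.
pose y i : R := b%:R `^ (- (lam * i%:R)).
apply: (@le_trans _ _ (\sum_(i < N) (y i - y i.+1))).
  apply: ler_sum => i _.
  have -> : y i = y i.+1 * b%:R `^ lam.
    by rewrite /y -powbD; congr (_ `^ _); rewrite -natr1; ring.
  rewrite -[X in _ - X]mulr1 -mulrBr ler_pM2l//.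
  by rewrite lerBrDl /powR (gt_eqF b0) expR_ge1Dx.
rewrite -(big_mkord xpredT (fun i => y i - y i.+1)).
rewrite (telescope_sumr_eq (fun i => - y i))//; last first.
  by move=> i _; rewrite opprK addrC.
by rewrite opprK addrC /y mulr0 oppr0 powRr0 gerBl ltW.
Qed.

(** The factor of digit [i] is [1 + (b - 1) z i], from the digit 0 and the [b - 1] others; it is at
    most [exp (b * z i)], and the [z i] are geometric. *)
Lemma weight_sum1 (lam a : R) N : 0 < lam ->
  \sum_(k < b ^ N) b%:R `^ (- (lam * mu1 b a k)) <=
  expR (b%:R / (lam * ln b%:R) * b%:R `^ (- (lam * a))).
Proof.
move=> l0.
pose F i d : R := b%:R `^ (- (lam * ((i.+1%:R + a) * h R d))).
rewrite (eq_bigr (fun k : 'I_(b ^ N) => \prod_(i < N) F i (digit b k i))); last first.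
  move=> k _; rewrite /mu1 (big_digit b1
    (fun i => (i%:R + a) * h R (ndigit b k i)) _ N)//; last first.
    by move=> i ki; rewrite /h [ndigit _ _ _]ki eqxx mulr0.
  rewrite mulr_sumr -sumrN.
  by elim/big_rec2: _ => [|i x y _ <-]; [rewrite powRr0|rewrite powbD].
rewrite (sum_prod_digit b1 N F).
pose z i : R := b%:R `^ (- (lam * (i.+1%:R + a))).
apply: (@le_trans _ _ (\prod_(i < N) expR (b%:R * z i))).
  apply: ler_prod => i _; apply/andP; split.
    by apply: sumr_ge0 => d _; exact: powR_ge0.
  apply: le_trans (expR_ge1Dx _).
  rewrite -(big_mkord xpredT (F i)) big_ltn ?(ltnW b1)//.
  rewrite {1}/F /h/= !mulr0 oppr0 powRr0 lerD2l.
  rewrite (eq_big_nat _ _ (F2 := fun=> z i)); last first.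
    by move=> d /andP[d0 _]; rewrite /F /h -lt0n d0 mulr1.
  by rewrite sumr_const_nat -[leLHS]mulr_natl (ler_pM2r (powb_gt0 _)) ler_nat leq_subr.
rewrite -expR_sum ler_expR -mulr_sumr -!mulrA ler_pM2l//.
rewrite mulrC (_ : \sum_(i < N) z i = b%:R `^ (- (lam * a)) *
  \sum_(i < N) b%:R `^ (- (lam * i.+1%:R))); last first.
  rewrite mulr_sumr; apply: eq_bigr => i _; rewrite /z -powbD; congr (_ `^ _).
  by ring.
by rewrite (ler_pM2l (powb_gt0 _)) geometric_le.
Qed.

Lemma weight_sum s (lam : R) (a : nat -> R) N : 0 < lam ->
  \sum_(K : grid b s N) b%:R `^ (- (lam * mu b a (grid_index K))) <=
  expR (b%:R / (lam * ln b%:R) * \sum_(j < s) b%:R `^ (- (lam * a j.+1))).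
Proof.
move=> l0.
under eq_bigr => K _.
  rewrite /mu mulr_sumr -sumrN.
  have -> : b%:R `^ (\sum_(j < s) - (lam * mu1 b (a j.+1) (tnth (grid_index K) j))) =
     \prod_(j < s) b%:R `^ (- (lam * mu1 b (a j.+1) (tnth (grid_index K) j))).
    by elim/big_rec2: _ => [|i x y _ <-]; [rewrite powRr0|rewrite powbD].
  over.
rewrite (sum_grid_index s N (fun j k => b%:R `^ (- (lam * mu1 b (a j.+1) k)))).
rewrite mulr_sumr expR_sum; apply: ler_prod => j _; rewrite weight_sum1// andbT.
by apply: sumr_ge0 => k _; exact: powR_ge0.
Qed.

Lemma weight_sum_fset s (lam : R) (a : nat -> R) (A : {fset s.-tuple nat}) :
  0 < lam ->
  \sum_(k <- A) b%:R `^ (- (lam * mu b a k)) <=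
  expR (b%:R / (lam * ln b%:R) * \sum_(j < s) b%:R `^ (- (lam * a j.+1))).
Proof.
move=> l0; have [N AN] := seq_tuple_lt_exp b1 s A.
apply: le_trans (weight_sum s lam a N l0).
pose F k := if k \in A then b%:R `^ (- (lam * mu b a k)) else 0 : R.
rewrite (eq_big_seq F); last by move=> k kA; rewrite /F kA.
have AB : (A `<=` [fset grid_index K | K : grid b s N])%fset.
  apply/fsubsetP => k kA; have [K ->] := grid_index_exists s N k (AN k kA).
  by apply/imfsetP; exists K.
rewrite (big_fset_incl _ AB)/=; last by move=> k _ /negbTE kA; rewrite /F kA.
rewrite big_imfset/=; last by move=> K L _ _; exact: grid_index_inj.
rewrite big_enum/=.
by apply: ler_sum => K _; rewrite /F; case: ifP.
Qed.

(** Each counted index contributes [b ^ (lam (M - mu)) >= 1] to the right-hand side. *)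
Lemma card_low_weight s (lam : R) (a : nat -> R) M (A : {fset s.-tuple nat}) :
  0 < lam -> (forall k, k \in A -> mu b a k <= M) ->
  #|` A|%:R <= b%:R `^ (lam * M) *
    expR (b%:R / (lam * ln b%:R) * \sum_(j < s) b%:R `^ (- (lam * a j.+1))).
Proof.
move=> l0 AM; rewrite -sum1_size natr_sum.
apply: le_trans (ler_wpM2l (ltW (powb_gt0 _)) (weight_sum_fset s lam a A l0)).
rewrite mulr_sumr big_seq [leRHS]big_seq; apply: ler_sum => k kA.
rewrite -powbD -mulrBr -[leLHS](powRr0 b%:R) ler_powR ?ler1n ?(ltnW b1)//.
by rewrite mulr_ge0 ?subr_ge0 ?AM// ltW.
Qed.

(** The count with [lam = 1] bounds all finite subsets alike, so the set cannot be infinite. *)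
Lemma finite_low_weight s (a : nat -> R) (M : R) :
  finite_set [set k : s.-tuple nat | mu b a k <= M].
Proof.
have [//|/infinite_set_fset inf] :=
  pselect (finite_set [set k : s.-tuple nat | mu b a k <= M]).
set Z := b%:R `^ (1 * M) * expR (b%:R / (1 * ln b%:R) *
  \sum_(j < s) b%:R `^ (- (1 * a j.+1))) : R.
have [A AM] := inf (Num.truncn Z).+1.
rewrite -(ler_nat R) => /(lt_le_trans (truncnS_gt Z)).
by rewrite ltNge card_low_weight// => k kA; exact: (AM k kA).
Qed.

Lemma mu_zero_index s (a : nat -> R) : mu b a (zero_index s) = 0.
Proof. by apply: big1 => j _; rewrite tnth_mktuple /mu1 big_geq. Qed.

(** [lam] remains free for the count, while the tail always uses exponent 1/2: [b ^ (- mu) <= b ^ (-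
    M / 2) * b ^ (- mu / 2)] when [mu > M]. As [M >= 0], the zero index is among those integrated
    exactly. *)
Lemma walsh_error_count s n (a : nat -> R) (lam M : R) : 0 <= M -> 0 < lam ->
  2 * (b%:R `^ (lam * M) * expR (b%:R / (lam * ln b%:R) *
    \sum_(j < s) b%:R `^ (- (lam * a j.+1)))) <= n%:R ->
  (walsh_error b a n s <= (b%:R `^ (- (2^-1 * M)) *
     expR (b%:R / (2^-1 * ln b%:R) *
       \sum_(j < s) b%:R `^ (- (2^-1 * a j.+1))))%:E)%E.
Proof.
move=> M0 l0 Zn; pose L := fset_set [set k : s.-tuple nat | mu b a k <= M].
have LE k : (k \in L) = (mu b a k <= M).
  rewrite in_fset_set; last exact: finite_low_weight.
  by apply/idP/idP => [/set_mem|/mem_set].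
apply: (walsh_error_upper b1 s n a L); rewrite ?fset_uniq ?LE ?mu_zero_index//.
  rewrite -(ler_nat R) natrM; apply: le_trans Zn; rewrite ler_pM2l//.
  by apply: card_low_weight => // k; rewrite LE.
move=> A; apply: le_trans (ler_wpM2l (ltW (powb_gt0 _)) (weight_sum_fset s 2^-1 a A _)) => //.
rewrite mulr_sumr big_mkcond/=; apply: ler_sum => k _; case: ifP => [|_]; last first.
  by rewrite mulr_ge0// ltW.
rewrite LE -ltNge => Mk.
by rewrite -powbD ler_powR ?ler1n ?(ltnW b1)//; lra.
Qed.

(** The zero algorithm suffices: the integral is the coefficient of index 0, whose weight is 0. *)
Lemma walsh_error_le1 s n (a : nat -> R) : (walsh_error b a n s <= 1)%E.
Proof.
apply: ge_ereal_inf.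
exists (worst_case_error (@walsh_space R b a s) (@walsh_norm R b a s)
  (algorithm [tuple [tuple 0 | _ < s] | _ < n] (fun=> 0))).
  exists [tuple [tuple 0 | _ < s] | _ < n], (fun=> 0); split => // i j.
  by rewrite !tnth_mktuple lexx ltr01.
apply: ge_ereal_sup => _ [f [_ f1] <-]; rewrite lee_fin /algorithm subr0.
have := walsh_coef_le b1 s a f (zero_index s) f1.
rewrite walsh_coef0 mu_zero_index oppr0 powRr0 normc_def/= expr0n/= addr0 sqrtr_sqr.
by rewrite lecR.
Qed.

End weight_sums.


(** * Decay rates *)

Section rates.
Context {R : realType} {b : nat} (b1 : (1 < b)%N).

Let b0 : 0 < b%:R :> R. Proof. by rewrite ltr0n ltnW. Qed.

Let lnb0 : 0 < ln (b%:R : R). Proof. by rewrite ln_gt0// ltr1n. Qed.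

Lemma powbE (x : R) : b%:R `^ x = expR (x * ln b%:R).
Proof. by rewrite /powR (gt_eqF b0). Qed.

(** The constants depend on [b], [p] and [K] only, so this serves a fixed [s] ([p = 2], [K]
    depending on [s]) as well as all [s] at once. *)
Lemma error_rate (p K : R) : 1 < p <= 2 -> 0 < K ->
  exists C c : R, [/\ 0 < C, 0 < c & forall s n (a : nat -> R), (1 <= n)%N ->
    (forall lam : R, 0 < lam <= 1 ->
      \sum_(j < s) b%:R `^ (- (lam * a j.+1)) <= K * lam `^ (- ((2 - p) / (p - 1)))) ->
    (walsh_error b a n s <= (C * expR (- (c * ln n%:R `^ p)))%:E)%E].
Proof.
move=> /andP[p1 p2] K0; set q := (2 - p) / (p - 1).
have p0 : 0 < p - 1 by lra.
have q0 : 0 <= q by rewrite /q; apply: divr_ge0; lra.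
(* [K2] collects the exponents of the three factors of the node count, namely 2, [b ^ (lam M)] and
   the weight sum, per unit of [y]; thus [y = ln n / K2] is affordable. *)
pose K1 := b%:R / ln b%:R * K; pose K2 := ln 2 + ln b%:R + K1.
have K10 : 0 < K1 by rewrite mulr_gt0 ?divr_gt0.
have ln20 : 0 < ln 2 :> R by rewrite ln_gt0// ltr1n.
have K20 : 0 < K2 by rewrite !addr_gt0.
(* The exponent of the weight sum at [lam = 1/2], which enters through the tail. *)
pose C0 : R := K1 * 2^-1 `^ (- (1 + q)).
have C00 : 0 <= C0 by rewrite mulr_ge0 ?powR_ge0// ltW.
pose c := ln b%:R / 2 * K2 `^ (- p).
exists (expR (C0 + ln b%:R / 2)), c; split.
- exact: expR_gt0.
- by rewrite mulr_gt0 ?powR_gt0// divr_gt0.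
move=> s n a n1 Sle; set L := ln (n%:R : R).
have L0 : 0 <= L by rewrite ln_ge0// ler1n.
pose y := L / K2; have y0 : 0 <= y by rewrite divr_ge0// ltW.
have cE : c * L `^ p = ln b%:R / 2 * y `^ p.
  rewrite /c /y powRM ?invr_ge0 ?(ltW K20)//.
  have -> : K2^-1 `^ p = K2 `^ (- p).
    by rewrite -(powR_inv1 (ltW K20)) -powRrM mulN1r.
  ring.
rewrite cE -expRD.
have expo_le lam : 0 < lam <= 1 ->
    b%:R / (lam * ln b%:R) * \sum_(j < s) b%:R `^ (- (lam * a j.+1)) <=
    K1 * lam `^ (- (1 + q)).
  move=> /[dup] /andP[l0 _] /Sle Sl.
  apply: (@le_trans _ _ (b%:R / (lam * ln b%:R) * (K * lam `^ (- q)))).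
    by rewrite ler_wpM2l// divr_ge0 ?ltW// mulr_gt0.
  rewrite opprD powRD ?(gt_eqF l0) ?implybT// (powR_inv1 (ltW l0)) /K1.
  rewrite le_eqVlt; apply/orP; left; apply/eqP; field.
  by rewrite ?(gt_eqF l0) ?(gt_eqF lnb0).
(* For [y < 1] the claimed bound is at least 1, thanks to the summand [ln b / 2] in the constant. *)
have [y1|y1] := ltP y 1.
  apply: le_trans (walsh_error_le1 b1 s n a) _; rewrite lee_fin.
  apply: le_trans (expR_ge1Dx _); rewrite lerDl.
  suff : y `^ p <= 1 by move=> yp; have := ler_wpM2l (ltW lnb0) yp; lra.
  have p_ge0 : 0 <= p by lra.
  have := ge0_ler_powR p_ge0 (x := y) (y := 1); rewrite powR1 !nnegrE.
  by apply => //; lra.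
have y_gt0 : 0 < y by lra.
(* This choice balances the two exponents: [lam * M = lam `^ (- (1 + q)) = y]. *)
pose lam := y `^ (1 - p); pose M := y `^ p.
have l0 : 0 < lam by rewrite powR_gt0.
have l1 : lam <= 1 by rewrite -[leRHS](powRr0 y) ler_powR//; lra.
have lM : lam * M = y.
  by rewrite /lam /M -powRD ?(gt_eqF y_gt0) ?implybT// subrK powRr1.
have lr : lam `^ (- (1 + q)) = y.
  rewrite /lam -powRrM (_ : (1 - p) * - (1 + q) = 1) ?powRr1//.
  by rewrite /q; field; rewrite gt_eqF.
have el : 2 * (b%:R `^ (lam * M) * expR (b%:R / (lam * ln b%:R) *
    \sum_(j < s) b%:R `^ (- (lam * a j.+1)))) <= n%:R.
  have n0 : (n%:R : R) \is Num.pos by rewrite posrE ltr0n.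
  have e2 : expR (ln 2) = 2 :> R by apply/eqP; rewrite lnK_eq.
  rewrite lM powbE -expRD -[X in X * _ <= _]e2.
  rewrite -expRD -[leRHS](lnK n0) ler_expR.
  have := expo_le lam (introT andP (conj l0 l1)); rewrite lr => h.
  apply: (@le_trans _ _ (ln 2 * y + (y * ln b%:R + K1 * y))).
    by apply: lerD; [rewrite ler_peMr// ltW|rewrite lerD2l].
  by rewrite -/L -[leRHS](divfK (lt0r_neq0 K20)) -/y /K2; lra.
apply: le_trans (walsh_error_count b1 s n a lam M (powR_ge0 _ _) l0 el) _.
rewrite lee_fin powbE -expRD ler_expR.
have half : 0 < (2^-1 : R) <= 1 by lra.
have := expo_le 2^-1 half; rewrite -/C0 /M => h.
have := ltW lnb0; lra.
Qed.

(** [exp (- u ^ th) <= C / (1 + u) ^ 2] for [u >= 0], and the latter, sampled with step [1 / X],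
    sums to at most [C X]. *)
Lemma sum_stretched_exp (th : R) : 0 < th ->
  exists2 C : R, 0 < C & forall (X : R) s, 0 < X ->
    \sum_(j < s) expR (- ((j.+1%:R / X) `^ th)) <= C * X.
Proof.
(* As [(n + 1) th > 2], for [u >= 1] the exponential series gives [u ^ 2 <= (u ^ th) ^ (n + 1) <= (n
   + 1)! exp (u ^ th)]; the 4 comes from [1 + u <= 2 max(1, u)]. *)
move=> th0; pose n := Num.truncn (2 / th); pose C : R := 4 * (n.+1)`!%:R.
have C0 : 0 < C by rewrite mulr_gt0// ltr0n fact_gt0.
exists C => // X s X0.
have bound u : 0 <= u -> (1 + u) ^+ 2 * expR (- (u `^ th)) <= C.
  move=> u0; have v0 : 0 <= u `^ th by exact: powR_ge0.
  have N1 : 1 <= (n.+1)`!%:R :> R by rewrite ler1n fact_gt0.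
  rewrite expRN ler_pdivrMr ?expR_gt0//.
  have [u1|u1] := leP u 1.
    have e1 : 1 <= expR (u `^ th) by rewrite -[leLHS]expR0 ler_expR.
    apply: (@le_trans _ _ (4 * 1)); first by nra.
    by rewrite /C -mulrA ler_pM2l// -[leLHS]mulr1 ler_pM.
  apply: (@le_trans _ _ (4 * u ^+ 2)); first by nra.
  rewrite /C -mulrA ler_pM2l//.
  have := expR_ge1Dxn n v0; set e := expR _ => he.
  apply: (@le_trans _ _ ((u `^ th) ^+ n.+1)).
    rewrite -powR_mulrn// -powR_mulrn// -powRrM ler_powR ?(ltW u1)//.
    by rewrite mulrC -ler_pdivrMr// ltW// truncnS_gt.
  rewrite mulrC -ler_pdivrMr ?ltr0n ?fact_gt0//; lra.
(* [1 / (1 + (i + 1) / X) ^ 2 <= X * (w i - w i.+1)], which telescopes. *)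
pose w i : R := (1 + i%:R / X)^-1.
have w0 i : 0 < 1 + i%:R / X by rewrite ltr_wpDr// divr_ge0// ltW.
apply: (@le_trans _ _ (\sum_(i < s) C * X * (w i - w i.+1))).
  apply: ler_sum => i _; pose u : R := i.+1%:R / X.
  have u0 : 0 <= u by rewrite divr_ge0// ltW.
  have wE : X * (w i - w i.+1) = ((1 + i%:R / X) * (1 + u))^-1.
    have E : 1 + u = (1 + i%:R / X) + X^-1 by rewrite /u -natr1; ring.
    rewrite /w -/u; have := w0 i; have := w0 i.+1; rewrite -/u E.
    move: (1 + i%:R / X) => D DX0 D0; have DX : 0 < D * X + 1.
      by rewrite ltr_wpDl// mulr_ge0 ?ltW.
    by field; rewrite !gt_eqF.
  rewrite -mulrA wE ler_pdivlMr ?mulr_gt0//; last exact: (w0 i.+1).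
  apply: le_trans (bound u u0); rewrite mulrC ler_wpM2r ?expR_ge0// expr2.
  rewrite ler_pM2r; last exact: (w0 i.+1).
  by rewrite lerD2l ler_pM2r ?invr_gt0// ler_nat.
rewrite -mulr_sumr -(big_mkord xpredT (fun i => w i - w i.+1)).
rewrite (telescope_sumr_eq (fun i => - w i))//; last first.
  by move=> i _; rewrite opprK addrC.
rewrite -[leRHS]mulr1 ler_pM2l ?mulr_gt0// opprK addrC /w mul0r addr0 invr1.
by rewrite gerBl invr_ge0 ltW.
Qed.

End rates.

(** * The growth condition (a) and the resulting weight sums *)

Lemma limn_einf_gt0P (R : realType) (u : (\bar R)^nat) :
  (0 < limn_einf u)%E <->
  exists g : R, 0 < g /\ exists J, forall j, (J <= j)%N -> (g%:E <= u j)%E.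
Proof.
have ndu := nondecreasing_einfs u.
have lE : limn_einf u = ereal_sup (range (einfs u)).
  by rewrite limn_einf_lim; apply/cvg_lim => //; exact: ereal_nondecreasing_cvgn.
rewrite lE; split.
  move=> /ereal_sup_gt[_ [J _ <-]] uJ.
  (* A tail infimum may be [+oo]; then any positive [g] will do. *)
  have [g [g0 gu]] : exists g : R, 0 < g /\ (g%:E <= einfs u J)%E.
    move: uJ; case: (einfs u J) => [r|_|//].
      by rewrite lte_fin => r0; exists r.
    by exists 1; rewrite ltr01 leey.
  exists g; split => //; exists J => j Jj; apply: le_trans gu _.
  by apply: ereal_inf_lbound; exists j.
move=> [g [g0 [J gu]]]; apply: (@lt_le_trans _ _ g%:E); first by rewrite lte_fin.
apply: le_ereal_sup_tmp; exists (einfs u J); first by exists J.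
by apply: le_ereal_inf_tmp => _ [j Jj <-]; exact: gu.
Qed.

Section summable_weights.
Context {R : realType} {b : nat} (b1 : (1 < b)%N).

Let b0 : 0 < b%:R :> R. Proof. by rewrite ltr0n ltnW. Qed.

Let lnb0 : 0 < ln (b%:R : R). Proof. by rewrite ln_gt0// ltr1n. Qed.

(** By monotonicity [- lam a_j <= - lam a_1 <= |a_1|], which controls negative weights. *)
Lemma weight_term_le (a : nat -> R) (lam : R) j :
  (forall i j, (1 <= i <= j)%N -> a i <= a j) -> 0 < lam <= 1 ->
  b%:R `^ (- (lam * a j.+1)) <= b%:R `^ `|a 1%N|.
Proof.
move=> amon /andP[l0 l1]; rewrite ler_powR ?ler1n ?(ltnW b1)//.
have h1 : - a 1%N <= `|a 1%N| by rewrite -normrN ler_norm.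
have h2 := amon 1%N j.+1 isT; have h3 := normr_ge0 (a 1%N); nra.
Qed.

(** Beyond [J] the terms are at most [exp (- (j / X) ^ th)] with [X = (lam g ln b) ^ (- 1 / th)].
    The first [J] terms are bounded one by one and absorbed because [lam ^ (- 1 / th) >= 1]. *)
Lemma weight_terms_summable (a : nat -> R) (th : R) : 0 < th ->
  (forall i j, (1 <= i <= j)%N -> a i <= a j) ->
  (0 < limn_einf (fun j => (a j / (j%:R `^ th))%:E))%E ->
  exists2 K : R, 0 < K & forall s (lam : R), 0 < lam <= 1 ->
    \sum_(j < s) b%:R `^ (- (lam * a j.+1)) <= K * lam `^ (- th^-1).
Proof.
move=> th0 amon /limn_einf_gt0P[g [g0 [J aJ]]].
have [C C0 CP] := sum_stretched_exp th th0.
pose B : R := b%:R `^ `|a 1%N|; pose G : R := (g * ln b%:R) `^ (- th^-1).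
have B0 : 0 < B by rewrite powR_gt0.
have gl0 : 0 < g * ln b%:R by rewrite mulr_gt0.
have G0 : 0 < G by rewrite powR_gt0.
exists (J%:R * B + C * G).
  by rewrite ltr_wpDl ?mulr_gt0// mulr_ge0// ltW.
move=> s lam lam01; have /andP[l0 l1] := lam01.
have lq1 : 1 <= lam `^ (- th^-1).
  rewrite -[leLHS](powRr0 lam) ger_powR ?lam01// oppr_le0 invr_ge0 ltW//.
pose X := lam `^ (- th^-1) * G; have X0 : 0 < X by rewrite mulr_gt0 ?powR_gt0.
have XE j : (j%:R / X) `^ th = lam * (g * ln b%:R) * j%:R `^ th.
  have XV : X^-1 = (lam * (g * ln b%:R)) `^ th^-1.
    by rewrite /X /G -powRM ?(ltW l0) ?(ltW gl0)// -powRN opprK.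
  rewrite XV (powRM _ (ler0n _ j) (powR_ge0 _ _)) -powRrM mulVf ?gt_eqF//.
  by rewrite powRr1 1?mulrC// mulr_ge0 ?ltW.
apply: (@le_trans _ _ (\sum_(j < s) ((j < J)%:R * B + expR (- ((j.+1%:R / X) `^ th))))).
  apply: ler_sum => j _; have [jJ|Jj] := ltnP j J.
    rewrite mul1r; apply: le_trans (weight_term_le _ _ _ amon lam01) _.
    by rewrite lerDl expR_ge0.
  rewrite mul0r add0r (powbE b1) ler_expR XE.
  have := aJ j.+1 (leqW Jj); rewrite lee_fin ler_pdivlMr ?powR_gt0// => h.
  by have := ler_wpM2l (ltW (mulr_gt0 l0 lnb0)) h; lra.
rewrite big_split/= mulrDl; apply: lerD; last first.
  by apply: le_trans (CP X s X0) _; rewrite /X mulrCA -mulrA mulrC mulrA mulrAC.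
rewrite -mulr_suml; apply: (@le_trans _ _ (J%:R * B)).
  rewrite ler_pM2r// -natr_sum ler_nat.
  suff h : (\sum_(j < s) (j < J) <= minn s J)%N.
    exact: leq_trans h (geq_minr _ _).
  elim: (s) => [|i IH]; first by rewrite big_ord0.
  rewrite big_ord_recr/=; apply: leq_trans (leq_add IH (leqnn _)) _.
  by case: ltnP; lia.
by rewrite ler_peMr// mulr_ge0// ltW.
Qed.

End summable_weights.


(** * Consequences of the lower bound *)

Section lower_consequences.
Context {R : realType} {b : nat} (b1 : (1 < b)%N).

Let b0 : 0 < b%:R :> R. Proof. by rewrite ltr0n ltnW. Qed.

Let lnb0 : 0 < ln (b%:R : R). Proof. by rewrite ln_gt0// ltr1n. Qed.

Lemma ln_natX_lt n k : (1 <= n)%N -> (n < b ^ k)%N = (ln (n%:R : R) < k%:R * ln b%:R).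
Proof.
move=> n1; rewrite -(ltr_nat R) natrX mulr_natl -(lnXn _ b0).
by apply/esym/ltr_ln; rewrite posrE ?ltr0n ?exprn_gt0.
Qed.

Lemma error_lower_fixed_dim s (a : nat -> R) : (1 <= s)%N ->
  exists c1 c2 : R, [/\ 0 < c1, 0 < c2 & forall n, (1 <= n)%N ->
    ((expR (- (ln n%:R ^+ 2 / (2 * s%:R * ln b%:R)) - c1 * ln n%:R - c2))%:E
      <= walsh_error b a n s)%E].
Proof.
move=> s1; have s0 : 0 < s%:R :> R by rewrite ltr0n.
set S := \sum_(j < s) Num.max 0 (a j.+1).
have S0 : 0 <= S by apply: sumr_ge0 => j _; rewrite le_max lexx.
(* Read off by expanding [s (u + 1) (u + 2) / 2 + (u + 1) S] at [u = log_b n / s]; the quadratic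
   part is [(log_b n) ^ 2 / (2 s)]. *)
exists (3 / 2 + S / s%:R), ((s%:R + S) * ln b%:R); split.
- by rewrite ltr_wpDr// divr_ge0// ltW.
- by rewrite mulr_gt0// ltr_wpDr.
move=> n n1; pose l := ln (n%:R : R) / ln b%:R.
have lE : ln n%:R = l * ln b%:R by rewrite divfK// gt_eqF.
have l0 : 0 <= l by rewrite divr_ge0 ?ln_ge0 ?ler1n ?(ltnW b1).
pose u := l / s%:R; have u0 : 0 <= u by rewrite divr_ge0// ltW.
have uE : l = u * s%:R by rewrite divfK// gt_eqF.
(* The least [m] with [n < b ^ (m s)]. *)
pose m := (Num.truncn u).+1.
have m_gt : u < m%:R := truncnS_gt u.
have m_le : m%:R <= u + 1.
  by have /truncn_itv/andP[h _] := u0; rewrite /m -natr1 lerD2r.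
have nb : (n < b ^ (m * s))%N.
  by rewrite ln_natX_lt// lE ltr_pM2r// natrM uE ltr_pM2r.
apply: le_trans (walsh_error_lower b1 s a n m nb); rewrite lee_fin.
rewrite (powbE b1) ler_expR -/S lE natrM.
have -> : m.+1%:R = m%:R + 1 :> R by rewrite natr1.
have -> : - ((l * ln b%:R) ^+ 2 / (2 * s%:R * ln b%:R)) -
    (3 / 2 + S / s%:R) * (l * ln b%:R) - (s%:R + S) * ln b%:R =
    - (s%:R * ((u + 1) * (u + 2) / 2) + (u + 1) * S) * ln b%:R.
  by rewrite uE; field; rewrite !gt_eqF.
rewrite ler_pM2r// lerN2; apply: lerD; last exact: ler_wpM2r.
rewrite ler_pM2l// ler_pM2r//; have : 0 <= m%:R :> R by rewrite ler0n.
by move: m_le; move: (m%:R : R) => z z_le z0; apply: ler_pM; lra.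
Qed.

Lemma ln_nat_unbounded (x : R) : exists2 n, (1 <= n)%N & x <= ln n%:R.
Proof.
exists (Num.truncn (expR x)).+1 => //.
by rewrite -[leLHS]expRK ler_ln ?posrE ?expR_gt0// ltW// truncnS_gt.
Qed.

Lemma no_uniform_rate (a : nat -> R) (A C c : R) : 0 <= A -> 0 <= C -> 0 < c ->
  (forall s n, (1 <= s)%N -> (1 <= n)%N ->
    (walsh_error b a n s <=
       (C * expR (A * s%:R) * expR (- (c * ln n%:R ^+ 2)))%:E)%E) -> False.
Proof.
(* [s] is so large that the quadratic coefficient [1 / (2 s ln b)] of the lower bound is at most
   [c / 2]. *)
move=> A0 C0 c0 H; pose s := (Num.truncn ((c * ln (b%:R : R))^-1)).+1.
have s0 : 0 < s%:R :> R by rewrite ltr0n.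
have cs : (2 * s%:R * ln b%:R)^-1 <= c / 2.
  have h : (c * ln (b%:R : R))^-1 < s%:R := truncnS_gt _.
  have cb : 0 < c * ln (b%:R : R) by rewrite mulr_gt0.
  rewrite -[leRHS]invrK lef_pV2 ?posrE ?invr_gt0 ?mulr_gt0 ?divr_gt0//.
  rewrite invf_div -mulrA ler_pM2l// -ler_pdivrMr//.
  by rewrite -invfM ltW.
have [c1 [c2 [c10 c20 low]]] := error_lower_fixed_dim s a isT.
pose D := c2 + C + A * s%:R.
have As : 0 <= A * s%:R by rewrite mulr_ge0.
have D0 : 0 <= D by rewrite /D; lra.
(* Both bounds together give [c / 2 * L ^ 2 <= c1 * L + D], which fails for [L] of this size. *)
have [n n1] := ln_nat_unbounded (1 + 2 * (c1 + D) / c).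
have := le_trans (low n n1) (H s n isT n1); rewrite lee_fin.
set L := ln _ => h Lbig.
have : expR (- (L ^+ 2 / (2 * s%:R * ln b%:R)) - c1 * L - c2) <=
    expR (C + A * s%:R - c * L ^+ 2).
  apply: le_trans h _; rewrite !expRD -!mulrA; apply: ler_wpM2r.
    by rewrite mulr_ge0 ?expR_ge0.
  (* [C <= exp C] moves the constant into the exponent. *)
  by apply: le_trans (expR_ge1Dx _); rewrite lerDr.
rewrite ler_expR => hh.
have L2 : 0 <= L ^+ 2 by rewrite sqr_ge0.
have := ler_wpM2l L2 cs => hc.
have q0 : 0 <= 2 * (c1 + D) / c by rewrite divr_ge0 ?ltW// mulr_gt0// ltr_wpDr.
have L1 : 1 <= L by lra.
have : 2 * (c1 + D) / c < L by lra.
rewrite ltr_pdivrMr// => hL.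
have := ler_wpM2r (_ : 0 <= L) L1 => /(_ (le_trans ler01 L1)) hD.
have : L * (2 * (c1 + D)) < L * (L * c) by rewrite ltr_pM2l//; lra.
have : D <= D * L by rewrite ler_peMr.
rewrite /D in hL *; nra.
Qed.

(** Take [n = b ^ (m s - 1)] with [m] just above [x = d s ^ th]. Comparing the exponents of both
    bounds and dividing by [m s] yields [2 x <= m + max 0 a_s + const], and [m <= x + 1] leaves one
    [x]. *)
Lemma rate_lower_weights (a : nat -> R) (p A C c : R) : 1 < p < 2 ->
  (forall i j, (1 <= i <= j)%N -> a i <= a j) -> 0 <= A -> 0 <= C -> 0 < c ->
  (forall s n, (1 <= s)%N -> (1 <= n)%N ->
    (walsh_error b a n s <=
       (C * expR (A * s%:R) * expR (- (c * (ln n%:R `^ p))))%:E)%E) ->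
  exists2 d : R, 0 < d & exists D : R, forall s, (2 <= s)%N ->
    d * s%:R `^ ((p - 1) / (2 - p)) - D <= Num.max 0 (a s).
Proof.
move=> /andP[p1 p2] amon A0 C0 c0 H; set th := (p - 1) / (2 - p).
have p10 : 0 < p - 1 by lra.
have p20 : 0 < 2 - p by lra.
pose c1 := c * (ln b%:R / 2) `^ p.
have c10 : 0 < c1 by rewrite mulr_gt0// powR_gt0// divr_gt0.
(* Solves [c1 d ^ (p - 1) = 2 d ln b]. Since [(th + 1) (p - 1) = th], this becomes
   [c1 (x s) ^ (p - 1) = 2 x ln b]. *)
pose d := (c1 / (2 * ln b%:R)) `^ (2 - p)^-1.
have d0 : 0 < d by rewrite powR_gt0// divr_gt0// mulr_gt0.
have dE : c1 * d `^ (p - 1) = 2 * ln b%:R * d.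
  have d2p : d `^ (2 - p) = c1 / (2 * ln b%:R).
    by rewrite /d -powRrM mulVf ?gt_eqF// powRr1// ltW// divr_gt0// mulr_gt0.
  have : d `^ (p - 1) * d `^ (2 - p) = d.
    rewrite -powRD ?(gt_eqF d0) ?implybT// (_ : _ + _ = 1) ?powRr1 ?ltW//.
    by ring.
  rewrite d2p => E; rewrite -[in RHS]E; field; by rewrite gt_eqF.
exists d => //; exists ((C + A + ln b%:R) / ln b%:R) => s s2.
have s1 : (1 <= s)%N by exact: ltnW.
have s0 : 0 < s%:R :> R by rewrite ltr0n.
set aplus := Num.max 0 (a s).
have as0 : 0 <= aplus by rewrite le_max lexx.
pose x := d * s%:R `^ th; have x0 : 0 <= x by rewrite mulr_ge0 ?powR_ge0// ltW.
pose m := (Num.truncn x).+1.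
have m0 : 0 < m%:R :> R by rewrite ltr0n.
have m_gt : x < m%:R := truncnS_gt x.
have m_le : m%:R <= x + 1.
  by have /truncn_itv/andP[h _] := x0; rewrite /m -natr1 lerD2r.
have ms2 : (2 <= m * s)%N by rewrite (leq_trans s2)// leq_pmull.
have msb : (b ^ (m * s).-1 < b ^ (m * s))%N by rewrite ltn_exp2l// prednK// ltnW.
pose L := ln ((b ^ (m * s).-1)%:R : R).
have LE : L = (m * s).-1%:R * ln b%:R by rewrite /L natrX lnXn// mulr_natl.
have := le_trans (walsh_error_lower b1 s a _ m msb) (H s (b ^ (m * s).-1)%N s1 _).
rewrite expn_gt0 (ltnW b1) => /(_ isT).
rewrite lee_fin (powbE b1) -/L; set T := _ + _ => h.
have {h} : expR (- T * ln b%:R) <= expR (C + A * s%:R - c * L `^ p).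
  apply: le_trans h _; rewrite !expRD -!mulrA; apply: ler_wpM2r.
    by rewrite mulr_ge0 ?expR_ge0.
  by apply: le_trans (expR_ge1Dx _); rewrite lerDr.
rewrite ler_expR => hh.
have T_le : T <= s%:R * m%:R * (m%:R + aplus).
  have S_le : \sum_(j < s) Num.max 0 (a j.+1) <= s%:R * aplus.
    apply: (@le_trans _ _ (\sum_(j < s) aplus)).
      apply: ler_sum => j _; rewrite ge_max as0/= le_max; apply/orP; right.
      by apply: amon; rewrite /= ltn_ord.
    by rewrite sumr_const card_ord mulr_natl.
  have mm : (m * m.+1)%:R / 2 <= m%:R * m%:R :> R.
    rewrite natrM -mulrA ler_pM2l// ler_pdivrMr// -natrM ler_nat.
    by rewrite muln2 -addnn -addn1 leq_add2l.
  have := ler_wpM2l (ltW s0) mm; have := ler_wpM2l (ltW m0) S_le.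
  by rewrite /T; lra.
(* [m s - 1 >= m s / 2], because [m s >= 2]. *)
have L_ge : m%:R * s%:R * (ln b%:R / 2) <= L.
  rewrite LE mulrA mulrAC ler_pM2r// ler_pdivrMr// -!natrM ler_nat.
  by move: (m * s)%N ms2 => k k2; clear -k2; lia.
have ms0 : 0 < m%:R * s%:R :> R by rewrite mulr_gt0.
have lb2 : 0 < ln b%:R / 2 :> R by rewrite divr_gt0.
have Lp : c1 * (m%:R * s%:R) `^ p <= c * L `^ p.
  have -> : c1 * (m%:R * s%:R) `^ p = c * (m%:R * s%:R * (ln b%:R / 2)) `^ p.
    by rewrite (powRM _ (ltW ms0) (ltW lb2)) /c1; ring.
  have mb0 : 0 <= m%:R * s%:R * (ln b%:R / 2) :> R by rewrite mulr_ge0 ?ltW.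
  rewrite ler_pM2l//; apply: ge0_ler_powR => //; rewrite ?nnegrE//; first lra.
  exact: le_trans L_ge.
have msp : m%:R * s%:R * (2 * ln b%:R * x) <= c1 * (m%:R * s%:R) `^ p.
  have pE : (m%:R * s%:R) `^ p = m%:R * s%:R * (m%:R * s%:R) `^ (p - 1) :> R.
    by rewrite mulr_powRB1 ?ltW//; lra.
  rewrite pE [leRHS]mulrCA ler_pM2l//.
  have xs0 : 0 <= x * s%:R by rewrite mulr_ge0.
  have xE : 2 * ln b%:R * x = c1 * (x * s%:R) `^ (p - 1).
    have -> : x * s%:R = d * s%:R `^ (th + 1).
      by rewrite /x powRD ?(gt_eqF s0) ?implybT// powRr1// mulrA.
    rewrite (powRM _ (ltW d0) (powR_ge0 _ _)) -powRrM mulrA dE /x mulrA.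
    congr (_ * _ `^ _); rewrite /th; field; by rewrite gt_eqF.
  rewrite xE ler_pM2l//; apply: ge0_ler_powR; rewrite ?nnegrE ?(ltW p10) ?(ltW ms0)//.
  by rewrite ler_pM2r// ltW.
have CA : C + A * s%:R <= m%:R * s%:R * (C + A).
  have m1 : 1 <= m%:R :> R by rewrite ler1n.
  have s1' : 1 <= s%:R :> R by rewrite ler1n.
  have h1 : s%:R <= m%:R * s%:R :> R by rewrite ler_peMl// ltW.
  have h2 : 1 <= m%:R * s%:R :> R by exact: le_trans h1.
  have := ler_wpM2r C0 h2; have := ler_wpM2r A0 h1; lra.
have Tb := ler_wpM2r (ltW lnb0) T_le.
have : m%:R * s%:R * (2 * ln b%:R * x) <=
    m%:R * s%:R * (C + A + (m%:R + aplus) * ln b%:R) by lra.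
rewrite ler_pM2l// => fin.
have mb := ler_wpM2r (ltW lnb0) m_le.
by rewrite lerBlDr -(ler_pM2r lnb0) mulrDl divfK ?gt_eqF// -/x; lra.
Qed.

End lower_consequences.

(** * Assembly of the three statements *)

Theorem theorem4p1 (R : realType) (b : nat) (a : nat -> R) :
  (2 <= b)%N ->
  (forall i j, (1 <= i <= j)%N -> a i <= a j) ->
  let e := walsh_error b a in
  [/\
    (forall s, (1 <= s)%N ->
      (exists c1 c2 c3 c4 : R,
        [/\ 0 < c1, 0 < c2, 0 < c3, 0 < c4 &
         forall n, (1 <= n)%N ->
          ((expR (- (ln n%:R ^+ 2 / (2 * s%:R * ln b%:R))
                  - c1 * ln n%:R - c2))%:E <= e n s)%E /\
          (e n s <= (c3 * expR (- (c4 * ln n%:R ^+ 2)))%:E)%E]) /\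
      (exists k1 k2 : R,
        [/\ 0 < k1, 0 < k2 &
         \forall n \near \oo,
          ((expR (- (k1 * ln n%:R ^+ 2)))%:E <= e n s)%E /\
          (e n s <= (expR (- (k2 * ln n%:R ^+ 2)))%:E)%E])),
    ~ (exists A C c : R,
        [/\ 0 <= A, 0 <= C, 0 < c &
         forall s n, (1 <= s)%N -> (1 <= n)%N ->
          (e n s <= (C * expR (A * s%:R) * expR (- (c * ln n%:R ^+ 2)))%:E)%E])
  & forall p : R, 1 < p < 2 ->
      let cond_a :=
        (0 < limn_einf
               (fun j => (a j / (j%:R `^ ((p - 1) / (2 - p))))%:E))%E in
      let cond_b :=
        exists A C c : R,
          [/\ 0 <= A, 0 <= C, 0 < c &
           forall s n, (1 <= s)%N -> (1 <= n)%N ->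
            (e n s <=
               (C * expR (A * s%:R) * expR (- (c * (ln n%:R `^ p))))%:E)%E] in
      let cond_c :=
        exists C c : R,
          [/\ 0 <= C, 0 < c &
           forall s n, (1 <= s)%N -> (1 <= n)%N ->
            (e n s <= (C * expR (- (c * (ln n%:R `^ p))))%:E)%E] in
      (cond_a <-> cond_b) /\ (cond_b <-> cond_c)].
Proof.
move=> b1 amon e.
have lnb0 : 0 < ln (b%:R : R) by rewrite ln_gt0// ltr1n.
have upper s : exists C c : R, [/\ 0 < C, 0 < c & forall n, (1 <= n)%N ->
    (e n s <= (C * expR (- (c * ln n%:R ^+ 2)))%:E)%E].
  (* At [p = 2] the power of [lam] required by [error_rate] is 0, so bounding the [s] terms by a
     constant is enough. *)
  pose K : R := s%:R * b%:R `^ `|a 1%N| + 1.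
  have K0 : 0 < K by rewrite ltr_wpDl// mulr_ge0// powR_ge0.
  have p2 : 1 < (2 : R) <= 2 by lra.
  have [C [c [C0 c0 H]]] := error_rate b1 2 K p2 K0.
  exists C, c; split => // n n1; have := H s n a n1.
  rewrite powR_mulrn ?ln_ge0 ?ler1n//; apply => lam lam01.
  rewrite subrr mul0r oppr0 powRr0 mulr1.
  apply: (@le_trans _ _ (\sum_(j < s) b%:R `^ `|a 1%N|)).
    by apply: ler_sum => j _; exact: weight_term_le.
  by rewrite sumr_const card_ord /K -[leLHS]mulr_natl lerDl.
split.
- move=> s s1.
  have [c1 [c2 [c10 c20 low]]] := error_lower_fixed_dim b1 s a s1.
  have [C [c [C0 c0 up]]] := upper s.
  split; first by exists c1, c2, C, c; split => // n n1; split; [exact: low|exact: up].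
  have s0 : 0 < s%:R :> R by rewrite ltr0n.
  pose k := (2 * s%:R * ln b%:R)^-1 : R.
  have k0 : 0 < k by rewrite invr_gt0 !mulr_gt0.
  (* For large [n], [1 <= L <= L ^ 2] merges the lower-order terms into [k1], and half of [c L ^ 2]
     absorbs the constant [C <= exp C]. *)
  exists (k + c1 + c2), (c / 2); split; [by rewrite !addr_gt0|by rewrite divr_gt0|].
  have [N N1 NL] := ln_nat_unbounded (1 + 2 * C / c).
  exists N => // n /= Nn; have n1 : (1 <= n)%N by exact: leq_trans Nn.
  have {NL} : 1 + 2 * C / c <= ln n%:R.
    by apply: le_trans NL _; rewrite ler_ln ?posrE ?ltr0n// ler_nat.
  set L := ln _ => NL.
  have q0 : 0 < 2 * C / c by rewrite divr_gt0// mulr_gt0.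
  have L1 : 1 <= L by lra.
  have LL : L <= L ^+ 2 by nra.
  split.
    apply: le_trans (low n n1); rewrite lee_fin ler_expR -/L -/k.
    have h1 := ler_wpM2l (ltW c10) LL.
    have h2 : c2 <= c2 * L ^+ 2 by rewrite ler_peMr// ?ltW//; lra.
    by lra.
  apply: le_trans (up n n1) _; rewrite lee_fin -/L.
  apply: (@le_trans _ _ (expR C * expR (- (c * L ^+ 2)))).
    apply: ler_wpM2r; first exact: expR_ge0.
    by apply: le_trans (expR_ge1Dx _); rewrite lerDr.
  rewrite -expRD ler_expR.
  have : 2 * C / c <= L by lra.
  rewrite ler_pdivrMr// => h; have := ler_wpM2r (ltW c0) LL; lra.
- move=> [A [C [c [A0 C0 c0 H]]]].
  exact: (no_uniform_rate b1 a A C c A0 C0 c0 H).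
- move=> p p12 cond_a cond_b cond_c; have /andP[p1 p2] := p12.
  pose th := (p - 1) / (2 - p).
  have th0 : 0 < th by rewrite divr_gt0; lra.
  have ac : cond_a -> cond_c.
    move=> ca; have [K K0 KP] := weight_terms_summable b1 a th th0 amon ca.
    have p12' : 1 < p <= 2 by lra.
    have [C [c [C0 c0 H]]] := error_rate b1 p K p12' K0.
    exists C, c; split; [exact: ltW|exact: c0|] => s n _ n1; apply: H => //.
    move=> lam lam01; have := KP s lam lam01.
    by rewrite /th invf_div.
  have cb : cond_c -> cond_b.
    move=> [C [c [C0 c0 H]]]; exists 0, C, c; split => // s n s1 n1.
    by rewrite mul0r expR0 mulr1; exact: H.
  have ba : cond_b -> cond_a.
    move=> [A [C [c [A0 C0 c0 H]]]].
    have [d d0 [D DP]] := rate_lower_weights b1 a p A C c p12 amon A0 C0 c0 H.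
    apply/limn_einf_gt0P; exists (d / 2); split; first by rewrite divr_gt0.
    (* From [s >= z] on, [D < D1 <= d / 2 * s ^ th], so half of the main term survives. *)
    pose D1 := `|D| + 1; have D10 : 0 < D1 by rewrite ltr_wpDl.
    pose z := (2 * D1 / d) `^ th^-1.
    exists (maxn 2 (Num.truncn z).+1) => s; rewrite geq_max => /andP[s2 sz].
    have s0 : 0 < s%:R :> R by rewrite ltr0n ltnW.
    rewrite lee_fin ler_pdivlMr ?powR_gt0//.
    have := DP s s2; rewrite -/th; set y := s%:R `^ th => hy.
    have zy : 2 * D1 / d <= y.
      have zs : z <= s%:R.
        by apply: le_trans (ltW (truncnS_gt z)) _; rewrite ler_nat.
      have -> : 2 * D1 / d = z `^ th.
        by rewrite /z -powRrM mulVf ?gt_eqF// powRr1// divr_ge0 ?mulr_ge0 ?ltW.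
      by apply: ge0_ler_powR; rewrite ?nnegrE ?powR_ge0 ?(ltW th0) ?(ltW s0).
    have {zy} : D1 <= d / 2 * y.
      by move: zy; rewrite ler_pdivrMr// => zy; lra.
    have DD := ler_norm D; have D0 := normr_ge0 D; rewrite /D1 => h.
    (* The lower bound is positive, so the maximum is [a s] and not 0. *)
    move: hy; rewrite le_max => /orP[hy|hy]; last by lra.
    lra.
  by split; split; [move/ac/cb|move/ba|move/ba/ac|move/cb].
Qed.
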